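(* Assume that the discrete spaces in the Darcy domain satisfy the following: there is $\beta>0$ independent of $h$ such that $$\sup_{\mathbf 0\ne\mathbf u\in\mathbf H^h_0(\Omega_{\mathrm D})}\frac{(\mathrm{div}\,\mathbf u,q)_{\Omega_{\mathrm D}}}{\|\mathbf u\|_{\mathbf H(\mathrm{div},\Omega_{\mathrm D})}}\ge\beta\|q\|_{\Omega_{\mathrm D}}\qquad\forall q\in L^h_0(\Omega_{\mathrm D}),$$ and $\mathrm{div}\,\mathbf H^h(\Omega_{\mathrm D})\subset L^h(\Omega_{\mathrm D})$, for all $h$. Then there are constants $0<c\le C$ independent of $h$ such that all eigenvalues of $(\mathcal P^h_{\mathrm D})^{-1}\mathcal A^h_{\mathrm D}$ lie in $[-C,-c]\cup[c,C]$. Consequently, the MINRES method preconditioned with $(\mathcal P^h_{\mathrm D})^{-1}$ yields the solution of linear systems $\mathcal A^h_{\mathrm D}x=b$, $b\in\mathbf H^h_0(\Omega_{\mathrm D})^*\times L^h_0(\Omega_{\mathrm D})^*$, in a number of iterations independent of $h$: for every $\varepsilon>0$ there is an integer $k$, independent of $h$, of $b$ and of the initial guess $x_0$, such that the $k$-th iterate satisfies $\|b-\mathcal A^h_{\mathrm D}x_k\|_{(\mathcal P^h_{\mathrm D})^{-1}}\le\varepsilon\|b-\mathcal A^h_{\mathrm D}x_0\|_{(\mathcal P^h_{\mathrm D})^{-1}}$.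
   Context: $\Omega_{\mathrm D}\subset\mathbb R^d$ ($d=2,3$) is a bounded polyhedral Lipschitz domain and $\mathbf K(\mathbf x)$ is a symmetric matrix field with $0<k_1|\boldsymbol\xi|^2\le\mathbf K(\mathbf x)\boldsymbol\xi\cdot\boldsymbol\xi\le k_2|\boldsymbol\xi|^2$ for a.e. $\mathbf x\in\Omega_{\mathrm D}$ and all $\boldsymbol\xi\ne\mathbf 0$. $(\cdot,\cdot)_{\Omega_{\mathrm D}}$ and $\|\cdot\|_{\Omega_{\mathrm D}}$ are the $L^2(\Omega_{\mathrm D})$ inner product and norm; $L^2_0(\Omega_{\mathrm D})=\{p\in L^2(\Omega_{\mathrm D}):(p,1)_{\Omega_{\mathrm D}}=0\}$. Discrete spaces. For each $h$ in a family of mesh sizes there is a shape-regular simplicial triangulation of $\overline\Omega_{\mathrm D}$ with elements of diameter at most $h$, and finite dimensional spaces of piecewise polynomials $\mathbf H^h(\Omega_{\mathrm D})\subset\mathbf H(\mathrm{div},\Omega_{\mathrm D})$, $L^h_0(\Omega_{\mathrm D})\subset L^2_0(\Omega_{\mathrm D})$, $L^h(\Omega_{\mathrm D})=L^h_0(\Omega_{\mathrm D})\oplus\mathbb P_0(\Omega_{\mathrm D})$, where $\mathbb P_0$ denotes constants. $\mathbf H^h_0(\Omega_{\mathrm D})=\mathbf H^h(\Omega_{\mathrm D})\cap\mathbf H_0(\mathrm{div},\Omega_{\mathrm D})$ is the subspace of fields with zero normal trace on $\partial\Omega_{\mathrm D}$. Operators. $A^h_{\mathrm D},D^h_{\mathrm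 D}:\mathbf H^h_0(\Omega_{\mathrm D})\to\mathbf H^h_0(\Omega_{\mathrm D})^*$ are given by $\langle A^h_{\mathrm D}\mathbf u,\mathbf v\rangle=(\mathbf K^{-1}\mathbf u,\mathbf v)_{\Omega_{\mathrm D}}$ and $\langle D^h_{\mathrm D}\mathbf u,\mathbf v\rangle=(\mathrm{div}\,\mathbf u,\mathrm{div}\,\mathbf v)_{\Omega_{\mathrm D}}$; $B^h_{\mathrm D}:\mathbf H^h_0(\Omega_{\mathrm D})\to L^h_0(\Omega_{\mathrm D})^*$ is given by $\langle B^h_{\mathrm D}\mathbf u,q\rangle=-(\mathrm{div}\,\mathbf u,q)_{\Omega_{\mathrm D}}$, with adjoint $(B^h_{\mathrm D})^{\mathtt t}$; $I^h_{\mathrm D}:L^h_0(\Omega_{\mathrm D})\to L^h_0(\Omega_{\mathrm D})^*$ is given by $\langle I^h_{\mathrm D}p,q\rangle=(p,q)_{\Omega_{\mathrm D}}$. Define, from $\mathbf H^h_0(\Omega_{\mathrm D})\times L^h_0(\Omega_{\mathrm D})$ to its dual, $$\mathcal A^h_{\mathrm D}=\begin{pmatrix}A^h_{\mathrm D}&(B^h_{\mathrm D})^{\mathtt t}\\ B^h_{\mathrm D}&0\end{pmatrix},\qquad\mathcal P^h_{\mathrm D}=\begin{pmatrix}A^h_{\mathrm D}+D^h_{\mathrm D}&0\\ 0&I^h_{\mathrm D}\end{pmatrix}.$$ Preconditioned MINRES. For a self-adjoint invertible $\mathcal A:X\to X^*$ and a self-adjoint positive definite $\mathcal P:X\to X^*$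 ($X$ finite dimensional), put $\|r\|_{\mathcal P^{-1}}^2=\langle r,\mathcal P^{-1}r\rangle$ for $r\in X^*$. Starting from $x_0$ with $r_0=b-\mathcal Ax_0$, the $k$-th iterate $x_k$ minimizes $\|b-\mathcal Ax\|_{\mathcal P^{-1}}$ over $x\in x_0+\mathrm{span}\{(\mathcal P^{-1}\mathcal A)^j\mathcal P^{-1}r_0:0\le j\le k-1\}$. *)

(* Defs.v *)
From HB Require Import structures.
From mathcomp Require Import all_boot all_order all_algebra.
From mathcomp Require Import all_classical all_reals all_analysis.
From mathcomp Require Import complex.
From mathcomp Require mpoly.

Set Implicit Arguments.
Unset Strict Implicit.
Unset Printing Implicit Defensive.

Import Order.TTheory GRing.Theory Num.Theory.
Import numFieldNormedType.Exports.

Local Open Scope classical_set_scope.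
Local Open Scope ring_scope.

Definition measure_mx_display : measure_display -> measure_display.
Proof. exact. Qed.

Section measurable_matrix.
Context {d} {T : measurableType d} (m n : nat).

(* The product sigma-algebra: the smallest one making all entries measurable. *)
Definition mx_cylinder : set (set 'M[T]_(m, n)) :=
  [set A | exists i j, exists2 B : set T,
     measurable B & A = (fun x : 'M[T]_(m, n) => x i j) @^-1` B].

Let mx_set0 : <<s mx_cylinder >> set0.
Proof. exact: sigma_algebra0. Qed.

Let mx_setC A : <<s mx_cylinder >> A -> <<s mx_cylinder >> (~` A).
Proof. exact: sigma_algebraC. Qed.

Let mx_bigcup (F : _^nat) : (forall i, <<s mx_cylinder >> (F i)) ->
  <<s mx_cylinder >> (\bigcup_i (F i)).
Proof. exact: sigma_algebra_bigcup. Qed.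

HB.instance Definition _ := @isMeasurable.Build (measure_mx_display d)
  'M[T]_(m, n) <<s mx_cylinder >> mx_set0 mx_setC mx_bigcup.

End measurable_matrix.

Section lebesgue_rV.
Context {R : realType}.
Local Open Scope ereal_scope.

Definition rv_cons n (p : R * 'rV[R]_n) : 'rV[R]_n.+1 := row_mx p.1%:M p.2.

Lemma measurable_rv_cons n : measurable_fun setT (@rv_cons n).
Proof.
apply: measurability; first by [].
move=> _ [_ [i [j [B mB ->]]] <-]; rewrite -comp_preimage.
have mj (k : 'I_n) : measurable_fun setT (fun v : 'rV[R]_n => v ord0 k).
  move=> _ C mC; rewrite setTI; apply: sub_sigma_algebra.
  by exists ord0, k, C.
suff : measurable_fun setT ((fun x : 'rV[R]_n.+1 => x i j) \o @rv_cons n).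
  by move=> /(_ measurableT B mB).
rewrite (ord1 i).
case: (splitP (j : 'I_(1 + n))) => k jk.
- have jE : (j : 'I_(1 + n)) = lshift n k by apply/val_inj.
  rewrite [X in measurable_fun _ X](_ : _ = fst); first exact: measurable_fst.
  apply/funext => p; rewrite /= jE /rv_cons.
  by apply: (etrans (row_mxEl _ _ _ _)); rewrite ord1 mxE eqxx mulr1n.
- have jE : (j : 'I_(1 + n)) = rshift 1 k by apply/val_inj.
  rewrite [X in measurable_fun _ X](_ : _ =
    (fun v : 'rV[R]_n => v ord0 k) \o snd).
    exact: measurableT_comp (mj k) measurable_snd.
  apply/funext => p; rewrite /= jE /rv_cons.
  exact: row_mxEr.
Qed.

Section step.
Variables (n : nat) (mu : {measure set 'rV[R]_n -> \bar R}).

Definition lebesgue_rvS : set 'rV[R]_n.+1 -> \bar R :=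
  pushforward (lebesgue_measure \x^ mu) (@rv_cons n).

Let lebesgue_rvS0 : lebesgue_rvS set0 = 0.
Proof. by rewrite /lebesgue_rvS /pushforward preimage_set0 measure0. Qed.

Let lebesgue_rvS_ge0 A : 0 <= lebesgue_rvS A.
Proof. by rewrite /lebesgue_rvS /pushforward; apply: measure_ge0. Qed.

Let lebesgue_rvS_sigma_additive : semi_sigma_additive lebesgue_rvS.
Proof.
have mc := @measurable_rv_cons n.
move=> F mF tF mUF; rewrite /lebesgue_rvS /pushforward preimage_bigcup.
apply: measure_semi_sigma_additive.
- by move=> i; rewrite -[X in measurable X]setTI; exact: mc.
- apply/trivIsetP => /= i j _ _ ij; rewrite -preimage_setI.
  by move/trivIsetP : tF => /(_ _ _ _ _ ij) ->//; rewrite preimage_set0.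
- by rewrite -preimage_bigcup -[X in measurable X]setTI; exact: mc.
Qed.

HB.instance Definition _ := isMeasure.Build _ _ _ lebesgue_rvS
  lebesgue_rvS0 lebesgue_rvS_ge0 lebesgue_rvS_sigma_additive.

End step.

(* [n]-dimensional Lebesgue measure, the [n]-fold product of the
   one-dimensional one. *)
Fixpoint lebesgue_rv n : {measure set 'rV[R]_n -> \bar R} :=
  match n with
  | 0%N => \d_((0 : 'rV[R]_0)%R)
  | n'.+1 => lebesgue_rvS (lebesgue_rv n')
  end.

End lebesgue_rV.

Section geometry.
Context {R : realType} {d : nat}.
Local Notation E := 'rV[R]_d.

(* The norm carried by ['rV[R]_d] in the library is the max-norm, hence a
   separate Euclidean one. *)
Definition edot (u v : E) : R := \sum_(i < d) u 0 i * v 0 i.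
Definition enorm (u : E) : R := Num.sqrt (edot u u).

Definition diameter (A : set E) : R :=
  sup [set enorm (x - y) | x in A & y in A].

(* The vertices of a simplex are the rows of [s]; [face s P] is the convex hull
   of those whose index satisfies [P] (empty when there is none). *)
Definition face m (s : 'M[R]_(m, d)) (P : pred 'I_m) : set E :=
  [set x | exists t : 'rV[R]_m,
     [/\ forall i, 0 <= t 0 i, forall i, ~~ P i -> t 0 i = 0,
         \sum_i t 0 i = 1 & x = t *m s]].

Definition simplex m (s : 'M[R]_(m, d)) : set E := face s predT.

Definition affinely_independent m (s : 'M[R]_(m, d)) : Prop :=
  forall t : 'rV[R]_m, \sum_i t 0 i = 0 -> t *m s = 0 -> t = 0.

Definition covers_by_simplices (Omega : set E) (Th : seq 'M[R]_(d.+1, d)) :=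
  (forall s, s \in Th -> affinely_independent s) /\
  closure Omega = [set x | exists2 s, s \in Th & simplex s x].

Definition triangulation (Omega : set E) (Th : seq 'M[R]_(d.+1, d)) : Prop :=
  covers_by_simplices Omega Th /\
  forall s t, s \in Th -> t \in Th ->
    simplex s `&` simplex t = face s [pred i | [exists j, row i s == row j t]].

Definition shape_regular (sigma : R) (Th : seq 'M[R]_(d.+1, d)) : Prop :=
  forall s, s \in Th -> exists z : E, exists2 rho : R,
    0 < rho /\ diameter (simplex s) <= sigma * rho &
    [set x | enorm (x - z) <= rho] `<=` simplex s.

(* Near each boundary point, [Omega] is the strict epigraph, in the direction
   of a unit vector [n], of a Lipschitz function [g] on the hyperplane
   orthogonal to [n]; [x - edot n x *: n] is the projection of [x] on it. *)
Definition lipschitz_boundary (Omega : set E) : Prop :=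
  forall z, closure Omega z -> ~ Omega z ->
  exists (n : E) (g : E -> R) (L r : R),
    [/\ enorm n = 1, 0 < r,
        forall x y, `|g x - g y| <= L * enorm (x - y) &
        forall x, enorm (x - z) < r ->
          (Omega x <-> g (x - edot n x *: n) < edot n x)].

Definition polyhedral_lipschitz_domain (Omega : set E) : Prop :=
  [/\ open Omega /\ connected Omega, Omega !=set0, bounded_set Omega,
      lipschitz_boundary Omega & exists Th, covers_by_simplices Omega Th].

End geometry.

Section function_spaces.
Context {R : realType} {d : nat}.
Local Notation E := 'rV[R]_d.
Local Notation mu := (@lebesgue_rv R d).
Implicit Types (Omega : set E) (f g phi : E -> R) (u v : E -> E).

Definition partial (i : 'I_d) phi : E -> R :=
  fun x => 'D_(delta_mx 0 i : E) phi x.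

Definition grad phi : E -> E := fun x => \row_i partial i phi x.

Fixpoint Ck (k : nat) phi : Prop :=
  match k with
  | 0%N => continuous phi
  | k'.+1 => continuous phi /\
      forall i, (forall x, derivable phi x (delta_mx 0 i : E)) /\
                Ck k' (partial i phi)
  end.

Definition smooth phi : Prop := forall k, Ck k phi.

Definition ae_eq_on Omega (V : Type) (f g : E -> V) : Prop :=
  {ae mu, forall x, Omega x -> f x = g x}.

(* Functions are handled through representatives; values outside [Omega] are
   irrelevant, hence the extension by [0]. *)
Definition L2 Omega f : Prop := (f \_ Omega) \in Lfun mu 2%:E.
Definition L2v Omega u : Prop := forall i, L2 Omega (fun x => u x 0 i).

Definition ip Omega f g : R := \int[mu]_(x in Omega) (f x * g x).
Definition ipv Omega u v : R := \int[mu]_(x in Omega) edot (u x) (v x).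

Definition L2norm Omega f : R := Num.sqrt (ip Omega f f).

Definition weak_div Omega u g : Prop :=
  forall phi, smooth phi ->
    compact (closure [set x | phi x != 0]) ->
    closure [set x | phi x != 0] `<=` Omega ->
    ipv Omega u (grad phi) = - ip Omega g phi.

Definition Hdiv Omega u g : Prop :=
  [/\ L2v Omega u, L2 Omega g & weak_div Omega u g].

(* The normal trace of [u], where [g] is the divergence of [u], is the
   functional on (traces of) functions smooth up to the boundary given by
   Green's formula [<u.n, phi> = (u, grad phi) + (div u, phi)]. *)
Definition normal_trace Omega u g phi : R :=
  ipv Omega u (grad phi) + ip Omega g phi.

Definition Hdiv0 Omega u g : Prop :=
  Hdiv Omega u g /\ forall phi, smooth phi -> normal_trace Omega u g phi = 0.

Definition Hdiv_norm Omega u g : R := Num.sqrt (ipv Omega u u + ip Omega g g).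

Definition piecewise_polynomial (Th : seq 'M[R]_(d.+1, d)) f : Prop :=
  forall s, s \in Th -> exists p : mpoly.mpoly d R,
    ae_eq_on (simplex s) f (fun x => mpoly.meval (fun i => x 0 i) p).

Definition elliptic Omega (k1 k2 : R) (K : E -> 'M[R]_d) : Prop :=
  (forall i j, measurable_fun Omega (fun x => K x i j)) /\
  {ae mu, forall x, Omega x -> (K x)^T = K x /\
     forall xi : 'cV[R]_d, xi != 0 ->
       [/\ 0 < k1 * (enorm xi^T) ^+ 2,
           k1 * (enorm xi^T) ^+ 2 <= edot (K x *m xi)^T xi^T &
           edot (K x *m xi)^T xi^T <= k2 * (enorm xi^T) ^+ 2]}.

End function_spaces.

Section discretization.
Context {R : realType} {d : nat}.
Local Notation E := 'rV[R]_d.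

(* A finite-dimensional subspace of [L^2] (or [H(div)]) is a [vectType] with a
   linear map choosing representatives, required to be injective modulo
   equality almost everywhere in [discretization_of] below. [dvg u] is a
   representative of the divergence of [fld u], which is unique almost
   everywhere. *)
Record discretization := Discretization {
  mesh : seq 'M[R]_(d.+1, d);
  Hh : vectType R;
  fld : {linear Hh -> (E -> E)};
  dvg : {linear Hh -> (E -> R^o)};
  Hh0 : {vspace Hh};
  Lh0 : vectType R;
  sca : {linear Lh0 -> (E -> R^o)} }.

Arguments fld {_}.
Arguments dvg {_}.
Arguments sca {_}.

Record discretization_of (Omega : set E) (sigma h : R) (D : discretization) :
    Prop := DiscretizationOf {
  mesh_triangulation : triangulation Omega (mesh D);
  mesh_shape_regular : shape_regular sigma (mesh D);
  mesh_size : forall s, s \in mesh D -> diameter (simplex s) <= h;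
  Hh_Hdiv : forall u : Hh D, Hdiv Omega (fld u) (dvg u);
  Hh_inj : forall u : Hh D, ae_eq_on Omega (fld u) (fun=> 0) -> u = 0;
  Hh_poly : forall (u : Hh D) i,
    piecewise_polynomial (mesh D) (fun x => fld u x 0 i);
  Hh0P : forall u : Hh D, u \in Hh0 D <-> Hdiv0 Omega (fld u) (dvg u);
  Lh0_L2 : forall q : Lh0 D, L2 Omega (sca q);
  Lh0_mean : forall q : Lh0 D, ip Omega (sca q) (fun=> 1) = 0;
  Lh0_inj : forall q : Lh0 D, ae_eq_on Omega (sca q) (fun=> 0) -> q = 0;
  Lh0_poly : forall q : Lh0 D, piecewise_polynomial (mesh D) (sca q) }.

(* [L^h = L^h_0 + P_0] *)
Definition Lh (Omega : set E) (D : discretization) (f : E -> R) : Prop :=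
  exists (q : Lh0 D) (c : R), ae_eq_on Omega f (fun x => sca q x + c).

(* [sup] is the supremum of a set of reals; it is [0] for the empty set, i.e.
   when [Hh0] is trivial, and the quotients are otherwise bounded by
   Cauchy-Schwarz. *)
Definition inf_sup (Omega : set E) (beta : R) (D : discretization) : Prop :=
  forall q : Lh0 D,
    beta * L2norm Omega (sca q) <=
    sup [set ip Omega (dvg u) (sca q) / Hdiv_norm Omega (fld u) (dvg u)
        | u in [set u : Hh D | u \in Hh0 D /\ u != 0]].

End discretization.

Arguments discretization : clear implicits.
Arguments fld {R d _}.
Arguments dvg {R d _}.
Arguments sca {R d _}.

Section operators.
Context {R : realType}.
Implicit Types X Y : vectType R.

Definition dual_space X : vectType R := 'Hom(X, R^o).

(* [linfun f] agrees with [f] only when [f] is linear; hence [operE] needs a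
   bilinear [a]. *)
Definition oper X Y (a : X -> Y -> R) : 'Hom(X, dual_space Y) :=
  linfun (fun x => linfun (fun y => a x y : R^o) : dual_space Y).

Lemma operE X Y (a : X -> Y -> R) :
  (forall y, linear (fun x => a x y : R^o)) ->
  (forall x, linear (fun y => a x y : R^o)) ->
  forall x y, (oper a x : 'Hom(Y, R^o)) y = a x y.
Proof.
move=> lx ly.
pose gy x := GRing.isLinear.Build R Y R^o *%R (fun y => a x y : R^o) (ly x).
pose fy x : {linear Y -> R^o} := HB.pack (fun y => a x y : R^o) (gy x).
have fx_lin : linear (fun x => linfun (fy x) : dual_space Y).
  move=> k x1 x2; apply/lfunP => y.
  by rewrite add_lfunE scale_lfunE !lfunE /=; exact: lx.
pose gx := GRing.isLinear.Build R X (dual_space Y) *:%R _ fx_lin.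
pose fx : {linear X -> dual_space Y} :=
  HB.pack (fun x => linfun (fy x) : dual_space Y) gx.
move=> x y.
have -> : oper a = linfun fx by [].
by rewrite (lfunE fx); exact: (lfunE (fy x)).
Qed.

Definition pairing X (r : dual_space X) (x : X) : R := (r : 'Hom(X, R^o)) x.

Definition adjoint X Y (B : 'Hom(X, dual_space Y)) : 'Hom(Y, dual_space X) :=
  oper (fun y x => pairing (B x) y).

Definition block X Y (A : 'Hom(X, dual_space X)) (Bt : 'Hom(Y, dual_space X))
    (B : 'Hom(X, dual_space Y)) (D : 'Hom(Y, dual_space Y)) :
    'Hom((X * Y)%type, dual_space (X * Y)%type) :=
  oper (fun x y => pairing (A x.1) y.1 + pairing (Bt x.2) y.1 +
                   pairing (B x.1) y.2 + pairing (D x.2) y.2).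

(* The identification of [X^* * Y^*] with [(X * Y)^*]. *)
Definition dual_pair X Y (b1 : dual_space X) (b2 : dual_space Y) :
    dual_space (X * Y)%type :=
  linfun (fun x : X * Y => pairing b1 x.1 + pairing b2 x.2 : R^o).

(* [T] acts on a real space; its eigenvalues are those of the complexification
   of a matrix of [T], so that their reality is not built into the notion. *)
Definition complex_eigenvalue X (T : 'End(X)) (lambda : R[i]) : bool :=
  eigenvalue (map_mx (real_complex R)
    (passmx.mxof (vbasis (fullv : {vspace X})) (vbasis (fullv : {vspace X})) T))
    lambda.

(* [P^-1] is the inverse of [P] when [P] is bijective, which is the case
   for positive definite [P]. *)
Section minres.
Variables (X : vectType R) (A P : 'Hom(X, dual_space X)).
Variables (b : dual_space X) (x0 : X).

Definition residual (x : X) : dual_space X := b - A x.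

Definition dual_norm (r : dual_space X) : R :=
  Num.sqrt (pairing r ((P^-1)%VF r)).

Definition krylov (k : nat) : {vspace X} :=
  <<[seq iter j (P^-1 \o A)%VF ((P^-1)%VF (residual x0)) | j <- iota 0 k]>>%VS.

Definition minres_iterate (k : nat) (x : X) : Prop :=
  x - x0 \in krylov k /\
  forall y, y - x0 \in krylov k ->
    dual_norm (residual x) <= dual_norm (residual y).

End minres.
End operators.

Section darcy.
Context {R : realType} {d : nat}.
Variables (Omega : set 'rV[R]_d) (K : 'rV[R]_d -> 'M[R]_d).
Variable D : discretization R d.

Local Notation V := (subvs_of (Hh0 D)).
Local Notation Q := (Lh0 D).

Definition AD : 'Hom(V, dual_space V) :=
  oper (fun u v : V =>
    ipv Omega (fun x => (invmx (K x) *m (fld (vsval u) x)^T)^T)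
              (fld (vsval v))).

Definition DD : 'Hom(V, dual_space V) :=
  oper (fun u v : V => ip Omega (dvg (vsval u)) (dvg (vsval v))).

Definition BD : 'Hom(V, dual_space Q) :=
  oper (fun (u : V) (q : Q) => - ip Omega (dvg (vsval u)) (sca q)).

Definition ID : 'Hom(Q, dual_space Q) :=
  oper (fun p q : Q => ip Omega (sca p) (sca q)).

Definition calA : 'Hom((V * Q)%type, dual_space (V * Q)%type) :=
  block AD (adjoint BD) BD 0.

Definition calP : 'Hom((V * Q)%type, dual_space (V * Q)%type) :=
  block (AD + DD) 0 0 ID.

End darcy.

(* Main.v *)
Require Import Defs.
From mathcomp Require Import all_boot all_order all_algebra.
From mathcomp Require Import all_classical all_reals all_analysis.
From mathcomp Require Import measurable_realfun complex ring lra.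

Import Order.TTheory GRing.Theory Num.Theory.
Import numFieldNormedType.Exports.

Local Open Scope classical_set_scope.
Local Open Scope ring_scope.

(** Let T = P^-1 A, which is self-adjoint for the inner product of P, and write
    |x| for the norm of P. Everything follows from two inequalities

      s |x|^2 <= |T x|^2 <= |x|^2

    with a constant s in ]0, 1] that depends only on the inf-sup constant and on
    the lower ellipticity bound of K (darcy_ge, darcy_le).

    The upper one is the Cauchy-Schwarz inequality (saddle_form_le). The lower
    one is the stability of saddle point problems (saddle_form_stable): given
    T (u, p) = (w, r), the second row says that the divergence of u is - r, the
    inf-sup condition in the first row bounds p, and testing the first row with
    u bounds u. It uses that the divergence of a field with zero normal trace
    belongs to the discrete pressure space; a priori this holds up to a constant,
    which is invisible because the fields with zero normal trace have
    divergences of zero mean (Hdiv0_mean, darcy_divergence_pressure).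

    The eigenvalues of T are real by self-adjointness, and the two inequalities
    confine their absolute values to [sqrt s, 1] (preconditioned_eigenvalues).

    For the iteration count, the operator S = 1 - T^2 satisfies 0 <= S <= 1 - s
    as a quadratic form, hence |S z| <= (1 - s) |z| (one_minus_sqr_contraction).
    The residual polynomial (1 - t^2)^m is admissible for the Krylov space of
    dimension 2 m, and the residual of the iterate 2 m is therefore at most
    (1 - s)^m times the initial one (minres_contraction).

    The analytic part establishes that the four forms of the method are
    well-defined bilinear forms: open sets are measurable for the product
    sigma-algebra, the inverse of K is measurable and essentially bounded, and
    products of square integrable functions are integrable. *)

(** * Bilinear forms and duality *)

Definition is_bilinear {R : realType} {X Y : lmodType R} (a : X -> Y -> R) :=
  (forall y, linear (fun x => a x y : R^o)) /\
  (forall x, linear (fun y => a x y : R^o)).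

Definition is_symmetric {R : realType} {X : lmodType R} (a : X -> X -> R) :=
  is_bilinear a /\ forall x y, a x y = a y x.

Lemma linear_formP {R : realType} {X : lmodType R} (f : X -> R) :
  (forall k x y, f (k *: x + y) = k * f x + f y) -> linear (f : X -> R^o).
Proof. by []. Qed.

Section bilinear_forms.
Context {R : realType} {X Y : lmodType R} {a : X -> Y -> R}.
Hypothesis ba : is_bilinear a.

Lemma bilPl k x x' y : a (k *: x + x') y = k * a x y + a x' y.
Proof. exact: (ba.1 y k x x'). Qed.

Lemma bilPr x k y y' : a x (k *: y + y') = k * a x y + a x y'.
Proof. exact: (ba.2 x k y y'). Qed.

Lemma bil0l y : a 0 y = 0.
Proof. by have := bilPl 1 0 0 y; rewrite scaler0 addr0; lra. Qed.

Lemma bil0r x : a x 0 = 0.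
Proof. by have := bilPr x 1 0 0; rewrite scaler0 addr0; lra. Qed.

Lemma bilZl k x y : a (k *: x) y = k * a x y.
Proof. by have := bilPl k x 0 y; rewrite bil0l !addr0. Qed.

Lemma bilZr k x y : a x (k *: y) = k * a x y.
Proof. by have := bilPr x k y 0; rewrite bil0r !addr0. Qed.

Lemma bilDl x x' y : a (x + x') y = a x y + a x' y.
Proof. by have := bilPl 1 x x' y; rewrite scale1r mul1r. Qed.

Lemma bilDr x y y' : a x (y + y') = a x y + a x y'.
Proof. by have := bilPr x 1 y y'; rewrite scale1r mul1r. Qed.

Lemma bilBl x x' y : a (x - x') y = a x y - a x' y.
Proof. by rewrite -scaleN1r bilDl bilZl mulN1r. Qed.

End bilinear_forms.

Section nonnegative_forms.
Context {R : realType} {X : lmodType R} {a : X -> X -> R}.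
Hypothesis sa : is_symmetric a.
Hypothesis a_ge0 : forall x, 0 <= a x x.

Let ba : is_bilinear a := sa.1.

Lemma form_CS x y : a x y ^+ 2 <= a x x * a y y.
Proof.
(* a at s x + t y, to be used with (s, t) = (a y y, - a x y) if a y y != 0 *)
have eqn s t : 0 <= s ^+ 2 * a x x + 2 * s * t * a x y + t ^+ 2 * a y y.
  have := a_ge0 (s *: x + t *: y).
  rewrite !(bilDl ba, bilDr ba) !(bilZl ba, bilZr ba) (sa.2 y x).
  by move/le_trans; apply; rewrite le_eqVlt; apply/orP; left; apply/eqP; ring.
have [y0|yn0] := eqVneq (a y y) 0.
  have [->|xy0] := eqVneq (a x y) 0; first by rewrite y0 expr0n mulr0.
  (* the form is affine in t here, and this t gives it the value -1 *)
  have := eqn 1 (- (a x x + 1) / (2 * a x y)).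
  rewrite y0 (_ : _ + _ = -1); first by lra.
  by field.
have yp : 0 < a y y by rewrite lt_def yn0 a_ge0.
have := eqn (a y y) (- a x y).
rewrite (_ : _ + _ = a y y * (a x x * a y y - a x y ^+ 2)); last by ring.
by rewrite pmulr_rge0// subr_ge0.
Qed.

Lemma form_CS_sqrt x y : `|a x y| <= Num.sqrt (a x x) * Num.sqrt (a y y).
Proof. by rewrite -sqrtrM// -sqrtr_sqr ler_wsqrtr// form_CS. Qed.

End nonnegative_forms.

Section riesz.
Context {R : realType}.
Implicit Types X Y : vectType R.

Lemma pairing_bilinear {X Y} (G : 'Hom(X, dual_space Y)) :
  is_bilinear (fun x y => pairing (G x) y).
Proof.
split=> [y|x] k u v; last by rewrite /pairing linearP.
by rewrite /pairing linearP /= add_lfunE scale_lfunE.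
Qed.

(** A linear map from a space to its dual whose quadratic form is definite is
    injective, hence bijective, as both spaces have the same dimension. *)
Lemma definite_lfunVK {X} (G : 'Hom(X, dual_space X)) :
  (forall x, pairing (G x) x = 0 -> x = 0) ->
  forall r, G ((G^-1)%VF r) = r.
Proof.
move=> G0 r; rewrite limg_lfunVK //.
suff -> : limg G = fullv by rewrite memvf.
apply/eqP; rewrite eqEdim subvf /= limg_dim_eq ?dimvf; last first.
  apply/eqP; rewrite -subv0; apply/subvP => x.
  rewrite memv_cap memv_ker memv0 => /andP[_ /eqP Gx0].
  by apply/eqP/G0; rewrite Gx0 /pairing zero_lfunE.
by rewrite /dim /= muln1.
Qed.

(** Orthogonal projection on W: the restriction of P to W is definite, so that
    the functional P z on W is represented by a vector of W. *)
Lemma projection_exists {X} (P : 'Hom(X, dual_space X)) (W : {vspace X}) (z : X) :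
  (forall x, pairing (P x) x = 0 -> x = 0) ->
  exists2 w, w \in W & forall v, v \in W -> pairing (P (z - w)) v = 0.
Proof.
move=> P0; have bP := pairing_bilinear P.
pose a (v w : subvs_of W) := pairing (P (vsval v)) (vsval w).
have ba : is_bilinear a.
  split=> [y|x] k u v; rewrite /a [vsval (_ + _)]linearP /=.
    exact: (bilPl bP).
  exact: (bilPr bP).
have aE v w : pairing (oper a v) w = a v w := operE ba.1 ba.2 v w.
pose r : dual_space (subvs_of W) := oper (fun x w => pairing (P x) (vsval w)) z.
have rE w : pairing r w = pairing (P z) (vsval w).
  apply: (@operE _ X (subvs_of W) (fun x w => pairing (P x) (vsval w))).
    by move=> y k u v; exact: (bilPl bP).
  by move=> x k u v; rewrite [vsval _]linearP; exact: (bilPr bP).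
exists (vsval ((oper a)^-1%VF r)); first exact: subvsP.
move=> v vW; rewrite (bilBl bP) -{1}(vsprojK vW) -rE.
have aVr : oper a ((oper a)^-1%VF r) = r.
  by apply: definite_lfunVK => x; rewrite aE => /P0 x0; apply: val_inj.
have -> : pairing r (vsproj W v) = a ((oper a)^-1%VF r) (vsproj W v).
  by rewrite -aE aVr.
by rewrite /a vsprojK// subrr.
Qed.

End riesz.

(** * Complex eigenvalues of real operators *)

Section complex_eigenvectors.
Import passmx.
Context {R : realType}.
Local Notation realC := (real_complex R).

Lemma Re_mul_real_mx {m n : nat} (v : 'rV[R[i]]_m) (M : 'M[R]_(m, n)) :
  map_mx (@complex.Re R) (v *m map_mx realC M) = map_mx (@complex.Re R) v *m M.
Proof.
apply/rowP => j; rewrite !mxE (big_morph (@complex.Re R) (id1 := 0) (op1 := +%R)) //.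
  by apply: eq_bigr => i _; rewrite !mxE; case: (v 0 i) => a b /=; ring.
by move=> [a b] [c d].
Qed.

Lemma Im_mul_real_mx {m n : nat} (v : 'rV[R[i]]_m) (M : 'M[R]_(m, n)) :
  map_mx (@complex.Im R) (v *m map_mx realC M) = map_mx (@complex.Im R) v *m M.
Proof.
apply/rowP => j; rewrite !mxE (big_morph (@complex.Im R) (id1 := 0) (op1 := +%R)) //.
  by apply: eq_bigr => i _; rewrite !mxE; case: (v 0 i) => a b /=; ring.
by move=> [a b] [c d].
Qed.

(** The vectors x and y are the real and imaginary parts of a complex
    eigenvector. *)
Lemma complex_eigenvector {X : vectType R} (T : 'End(X)) (lambda : R[i]) :
  complex_eigenvalue T lambda -> exists x y : X,
    [/\ x != 0 \/ y != 0,
        T x = complex.Re lambda *: x - complex.Im lambda *: y &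
        T y = complex.Re lambda *: y + complex.Im lambda *: x].
Proof.
case: lambda => a b /eigenvalueP [v vM v0] /=.
set e := vbasis _ in vM; set M := mxof e e T in vM.
have eb : basis_of fullv e by exact: vbasisP.
pose vr := map_mx (@complex.Re R) v; pose vi := map_mx (@complex.Im R) v.
have vrM : vr *m M = a *: vr - b *: vi.
  rewrite -Re_mul_real_mx vM; apply/rowP => j; rewrite !mxE.
  by case: (v 0 j) => c d /=.
have viM : vi *m M = a *: vi + b *: vr.
  rewrite -Im_mul_real_mx vM; apply/rowP => j; rewrite !mxE.
  by case: (v 0 j) => c d /=.
exists (vecof e vr), (vecof e vi); split.
- rewrite !vecof_eq0 ?basis_free//.
  apply/orP; move: v0; apply: contraNT; rewrite negb_or !negbK.
  move=> /andP[/eqP vr0 /eqP vi0]; apply/eqP/rowP => j.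
  have := congr1 (fun u : 'rV_ _ => u 0 j) vr0; rewrite !mxE.
  have := congr1 (fun u : 'rV_ _ => u 0 j) vi0; rewrite !mxE.
  by case: (v 0 j) => c d /= -> ->.
- by rewrite (hom_vecof _ eb) vrM linearB !linearZ.
- by rewrite (hom_vecof _ eb) viM linearD !linearZ.
Qed.

End complex_eigenvectors.

(** * Eigenvalues and minimal residuals of preconditioned operators *)

Section preconditioned.
Context {R : realType} {X : vectType R} (A P : 'Hom(X, dual_space X)).
Hypothesis A_sym : forall x y, pairing (A x) y = pairing (A y) x.
Hypothesis P_sym : forall x y, pairing (P x) y = pairing (P y) x.
Hypothesis P_ge0 : forall x, 0 <= pairing (P x) x.
Hypothesis P_eq0 : forall x, pairing (P x) x = 0 -> x = 0.

Local Notation T := (P^-1 \o A)%VF.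
Local Notation "<< x , y >>" := (pairing (P x) y).

Let bP := pairing_bilinear P.

Lemma preconditionedE x y : << T x , y >> = pairing (A x) y.
Proof. by rewrite comp_lfunE definite_lfunVK. Qed.

Lemma preconditioned_selfadjoint x y : << T x , y >> = << x , T y >>.
Proof. by rewrite (P_sym x) !preconditionedE A_sym. Qed.

(** Apply the Cauchy-Schwarz type hypothesis to x and T x. *)
Lemma preconditioned_le1 :
  (forall x y, pairing (A x) y ^+ 2 <= << x , x >> * << y , y >>) ->
  forall x, << T x , T x >> <= << x , x >>.
Proof.
move=> AP x; have := AP x (T x); rewrite -preconditionedE expr2.
have [->|n0] := eqVneq << T x , T x >> 0; first by rewrite P_ge0.
by rewrite ler_pM2r// lt_def n0 P_ge0.
Qed.

Context {s : R}.
Hypothesis s_gt0 : 0 < s.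
Hypothesis T_ge : forall x, s * << x , x >> <= << T x , T x >>.
Hypothesis T_le : forall x, << T x , T x >> <= << x , x >>.

Lemma form_gt0 x : x != 0 -> 0 < << x , x >>.
Proof.
by move=> x0; rewrite lt_def P_ge0 andbT; apply: contra_neq x0; exact: P_eq0.
Qed.

Lemma real_eigenvalue_bounds t x : x != 0 -> T x = t *: x ->
  Num.sqrt s <= `|t| <= 1.
Proof.
move=> /form_gt0 x0 Tx; have := T_le x; have := T_ge x.
rewrite Tx (bilZl bP) (bilZr bP) mulrA -expr2 ler_pM2r//.
rewrite -[X in _ * _ <= X]mul1r ler_pM2r// => st t1.
rewrite -[`|t|]sqrtr_sqr; apply/andP; split; first exact: ler_wsqrtr.
by rewrite -sqrtr1 ler_wsqrtr.
Qed.

(** With T x = t x - b y and T y = t y + b x, self-adjointness of T for the inner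
    product of P gives b (|x|^2 + |y|^2) = 0. *)
Lemma preconditioned_eigenvalues (lambda : R[i]) :
  complex_eigenvalue T lambda ->
  exists2 t : R, lambda = (t%:C)%C & Num.sqrt s <= `|t| <= 1.
Proof.
move=> /complex_eigenvector[x [y [xy0 Tx Ty]]].
set t := complex.Re lambda in Tx Ty; set b := complex.Im lambda in Tx Ty.
have b0 : b = 0.
  have := preconditioned_selfadjoint x y.
  rewrite Tx Ty (bilBl bP) (bilDr bP) !(bilZl bP, bilZr bP) => bxy.
  have : b * (<< x , x >> + << y , y >>) = 0 by lra.
  move/eqP; rewrite mulf_eq0 => /orP[/eqP//|/eqP xy].
  have := P_ge0 x; have := P_ge0 y.
  by case: xy0 => /form_gt0; lra.
exists t; first by rewrite [LHS]complexE -/t -/b b0 mulr0 addr0.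
by case: xy0 => n0; apply: (real_eigenvalue_bounds t _ n0);
  rewrite ?Tx ?Ty b0 scale0r ?subr0 ?addr0.
Qed.

Local Notation S := (fun z => z - T (T z)).

(** S = 1 - T^2 is self-adjoint with 0 <= S <= 1 - s as quadratic forms. The
    bound on its norm comes from the Cauchy-Schwarz inequality of the form
    <S x, y> at z and S z, which avoids diagonalizing T. *)
Lemma one_minus_sqr_contraction z :
  << S z , S z >> <= (1 - s) ^+ 2 * << z , z >>.
Proof.
pose a x y := << x , y >> - << T x , T y >>.
have aE x y : a x y = << S x , y >>.
  by rewrite /a (bilBl bP) (preconditioned_selfadjoint (T x)).
have sa : is_symmetric a.
  split; last by move=> x y; rewrite /a P_sym (P_sym (T x)).
  by split=> [y|x]; apply: linear_formP => k u v;
    rewrite /a (linearP T) !(bilPl bP, bilPr bP); ring.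
have a_ge0 x : 0 <= a x x by rewrite subr_ge0.
have a_le x : a x x <= (1 - s) * << x , x >> by rewrite /a; have := T_ge x; lra.
have := form_CS sa a_ge0 z (S z); rewrite aE.
set n := << S z , S z >>; rewrite expr2.
have [->|n0] := eqVneq n 0; first by rewrite mulr_ge0// sqr_ge0.
have n_gt0 : 0 < n by rewrite lt_def n0 P_ge0.
move=> /le_trans => /(_ _ (ler_pM _ _ (a_le _) (a_le _))) => /(_ (a_ge0 _) (a_ge0 _)).
rewrite mulrACA -expr2 -/n mulrA ler_pM2r//.
Qed.

Lemma iter_contraction m z :
  << iter m S z , iter m S z >> <= ((1 - s) ^+ m) ^+ 2 * << z , z >>.
Proof.
elim: m => [|m IH]; first by rewrite expr0 expr1n mul1r.
rewrite iterS; apply: le_trans (one_minus_sqr_contraction _) _.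
by rewrite [_ ^+ m.+1]exprS exprMn -[leRHS]mulrA ler_wpM2l// sqr_ge0.
Qed.

Variables (b : dual_space X) (x0 : X).
Local Notation z0 := ((P^-1)%VF (residual A b x0)).
Local Notation krylov := (krylov A P b x0).

(** Residuals are measured through their images under P^-1, in the norm of P. *)
Lemma dual_norm_residual x :
  dual_norm P (residual A b x) =
  Num.sqrt << z0 - T (x - x0) , z0 - T (x - x0) >>.
Proof.
rewrite /dual_norm; set r := residual A b x.
suff -> : z0 - T (x - x0) = (P^-1)%VF r by rewrite definite_lfunVK.
by rewrite comp_lfunE -linearB /r /residual (linearB A) opprB addrA subrK.
Qed.

(** The iterate is found by projecting the preconditioned initial residual
    orthogonally on the image of the Krylov space under T. *)
Lemma minres_iterate_exists k : exists x, minres_iterate A P b x0 k x.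
Proof.
have [w /memv_imgP[y yK wE] w_orth] :=
  projection_exists P (T @: krylov k)%VS z0 P_eq0.
exists (x0 + y); split; first by rewrite addrC addKr.
move=> y' y'K; rewrite !dual_norm_residual [x0 + y]addrC addrK -wE ler_wsqrtr//.
set v := T (y' - x0); have -> : z0 - v = (z0 - w) + (w - v).
  by rewrite addrA subrK.
have wv : w - v \in (T @: krylov k)%VS by rewrite wE -linearB memv_img// rpredB.
move: (w_orth _ wv) => {w_orth wv}; move: (z0 - w) (w - v) => p q pq0.
rewrite (bilDl bP) !(bilDr bP) (P_sym q p) pq0.
by rewrite addr0 add0r lerDl.
Qed.

Lemma krylovS k : (krylov k <= krylov k.+1)%VS.
Proof.
apply: sub_span => _ /mapP[j jk ->]; apply/mapP; exists j => //.
by move: jk; rewrite !mem_iota !add0n => /ltnW.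
Qed.

Lemma krylov_image k y : y \in krylov k -> T y \in krylov k.+1.
Proof.
move=> yK; apply: subvP (memv_img T yK); rewrite limg_span.
apply: sub_span => v /mapP[_ /mapP[j jk ->] ->].
by apply/mapP; exists j.+1 => //; move: jk; rewrite !mem_iota !add0n.
Qed.

(** The polynomial (1 - t^2)^m has degree 2 m and equals 1 at 0, so that it is a
    residual polynomial of the Krylov space of dimension 2 m. *)
Lemma krylov_iter m : exists2 y, y \in krylov m.*2 & iter m S z0 = z0 - T y.
Proof.
elim: m => [|m [y yK IH]]; first by exists 0; rewrite ?mem0v// linear0 subr0.
exists (y + T (iter m S z0)); last first.
  by rewrite iterS (linearD T) opprD addrA -IH.
rewrite doubleS rpredD//; first exact: (subvP (krylovS _) _ (subvP (krylovS _) _ yK)).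
rewrite IH linearB rpredB//; last by do 2 apply: krylov_image.
by apply: memv_span; apply/mapP; exists 1%N.
Qed.

Lemma minres_contraction m x : minres_iterate A P b x0 m.*2 x ->
  dual_norm P (residual A b x) <=
  `|(1 - s) ^+ m| * dual_norm P (residual A b x0).
Proof.
move=> [_ x_min]; have [y yK yE] := krylov_iter m.
apply: le_trans (x_min (y + x0) _) _; first by rewrite addrK.
rewrite !dual_norm_residual addrK -yE subrr linear0 subr0.
by rewrite -sqrtr_sqr -sqrtrM ?sqr_ge0// ler_wsqrtr// iter_contraction.
Qed.

End preconditioned.

Lemma geometric_le_eps {R : realType} (q eps : R) : `|q| < 1 -> 0 < eps ->
  exists m : nat, `|q ^+ m| <= eps.
Proof.
move=> q1 eps0; have := cvg_expr q1.
move=> /cvgrPdist_le /(_ _ eps0) [m _ /(_ m)] /=.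
by rewrite leqnn sub0r normrN => /(_ isT) ?; exists m.
Qed.

(** * Stability of saddle point forms *)

Definition saddle_form {R : realType} {V Q : lmodType R}
    (a : V -> V -> R) (b : V -> Q -> R) (x y : V * Q) : R :=
  a x.1 y.1 + b y.1 x.2 + b x.1 y.2.

Definition block_diagonal_form {R : realType} {V Q : lmodType R}
    (a dd : V -> V -> R) (m : Q -> Q -> R) (x y : V * Q) : R :=
  a x.1 y.1 + dd x.1 y.1 + m x.2 y.2.

(** The three terms bound a u u, dd u u and m p p, in this order, in
    saddle_form_stable. *)
Definition stability_constant {R : realType} (gamma : R) : R :=
  (2 + 2 / gamma) ^+ 2 + 1 + ((4 + 2 / gamma) / gamma) ^+ 2.

Lemma stability_constant_ge1 {R : realType} (gamma : R) :
  1 <= stability_constant gamma.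
Proof.
rewrite /stability_constant.
have := sqr_ge0 (2 + 2 / gamma); have := sqr_ge0 ((4 + 2 / gamma) / gamma).
lra.
Qed.

(** In the application, a is the weighted inner product of the fields, dd the
    inner product of their divergences, m that of the pressures and b the
    coupling. The hypothesis divV says that the divergence of u is the pressure
    q0, up to sign. *)
Section saddle_point.
Context {R : realType} {V Q : lmodType R}.
Context {a dd : V -> V -> R} {m : Q -> Q -> R} {b : V -> Q -> R}.
Hypotheses (sa : is_symmetric a) (sdd : is_symmetric dd) (sm : is_symmetric m).
Hypothesis bb : is_bilinear b.
Hypotheses (a_ge0 : forall u, 0 <= a u u) (dd_ge0 : forall u, 0 <= dd u u).
Hypotheses (m_ge0 : forall q, 0 <= m q q) (m_eq0 : forall q, m q q = 0 -> q = 0).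
Hypothesis divV : forall u, exists2 q0, forall q, b u q = m q0 q & dd u u = m q0 q0.

Local Notation sform := (saddle_form a b).
Local Notation dform := (block_diagonal_form a dd m).

(** If pu and pv are the pressures of u and v given by divV, the left-hand side
    pairs (u, p, pu) with (v, pv, q), and |pu|, |pv| are the dd-norms of u, v:
    hence the constant 1, by the Cauchy-Schwarz inequality in dimension 3. *)
Lemma saddle_form_le x y : sform x y ^+ 2 <= dform x x * dform y y.
Proof.
case: x y => [u p] [v q]; rewrite /saddle_form /block_diagonal_form /=.
have [pu pE ddu] := divV u; have [pv vE ddv] := divV v.
rewrite vE pE ddu ddv (sm.2 pv p).
have := form_CS_sqrt sa a_ge0 u v.
have := form_CS_sqrt sm m_ge0 p pv.
have := form_CS_sqrt sm m_ge0 pu q.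
rewrite -{2}(sqr_sqrtr (a_ge0 u)) -{2}(sqr_sqrtr (a_ge0 v)).
rewrite -{2}(sqr_sqrtr (m_ge0 p)) -{2}(sqr_sqrtr (m_ge0 q)).
rewrite -{2}(sqr_sqrtr (m_ge0 pu)) -{2}(sqr_sqrtr (m_ge0 pv)).
have := sqrtr_ge0 (a u u); have := sqrtr_ge0 (a v v).
have := sqrtr_ge0 (m p p); have := sqrtr_ge0 (m q q).
have := sqrtr_ge0 (m pu pu); have := sqrtr_ge0 (m pv pv).
move: (Num.sqrt (a u u)) (Num.sqrt (a v v)) (Num.sqrt (m p p)) (Num.sqrt (m q q))
  (Num.sqrt (m pu pu)) (Num.sqrt (m pv pv)) (a u v) (m p pv) (m pu q).
move=> x1 y1 x3 y3 x2 y2 auv mpv mpu y20 x20 y30 x30 y10 x10 h1 h2 h3.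
apply: (@le_trans _ _ ((x1 * y1 + x3 * y2 + x2 * y3) ^+ 2)).
  rewrite -[leLHS]real_normK ?num_real// lerXn2r ?nnegrE//.
    by rewrite !addr_ge0// mulr_ge0.
  apply: le_trans (ler_normD _ _) _; rewrite lerD//.
  by apply: le_trans (ler_normD _ _) _; rewrite lerD.
have := sqr_ge0 (x1 * y2 - x3 * y1); have := sqr_ge0 (x1 * y3 - x2 * y1).
have := sqr_ge0 (x3 * y3 - x2 * y2).
lra.
Qed.

Context {gamma : R}.
Hypothesis gamma_gt0 : 0 < gamma.
Hypothesis infsup : forall p M, 0 <= M ->
  (forall v, b v p <= M * Num.sqrt (a v v + dd v v)) ->
  gamma * Num.sqrt (m p p) <= M.

(** Let z = (w, r) be the preconditioned image of x = (u, p), and N its norm. The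
    second row gives |dd u| = |r| <= N. The inf-sup condition in the first row
    bounds |p| by (|u| + 2 N) / gamma, and the first row tested with u bounds
    |u|^2 by N |p| + N |u| + N^2. Together these give |u| <= (2 + 2 / gamma) N. *)
Lemma saddle_form_stable x z :
  (forall y, sform x y = dform z y) ->
  dform x x <= stability_constant gamma * dform z z.
Proof.
case: x z => [u p] [w r] xz.
have eqV v : a u v + b v p = a w v + dd w v.
  have := xz (v, 0); rewrite /saddle_form /block_diagonal_form /=.
  by rewrite (bil0r bb) (bil0r sm.1) !addr0.
have eqQ q : b u q = m r q.
  have := xz (0, q); rewrite /saddle_form /block_diagonal_form /=.
  by rewrite (bil0l bb) !(bil0r sa.1) (bil0r sdd.1) !addr0 !add0r.
have ddu : dd u u = m r r.
  have [q0 q0E ->] := divV u.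
  suff -> : r = q0 by [].
  apply/eqP; rewrite -subr_eq0; apply/eqP/m_eq0.
  by rewrite {1}(bilBl sm.1) -eqQ -q0E subrr.
rewrite /block_diagonal_form /= ddu.
set N2 := a w w + dd w w + m r r.
pose N := Num.sqrt N2.
have N2_ge0 : 0 <= N2 by rewrite !addr_ge0.
have N_ge0 : 0 <= N := sqrtr_ge0 _.
have wN : Num.sqrt (a w w) <= N.
  by rewrite ler_wsqrtr// /N2; have := dd_ge0 w; have := m_ge0 r; lra.
have dwN : Num.sqrt (dd w w) <= N.
  by rewrite ler_wsqrtr// /N2; have := a_ge0 w; have := m_ge0 r; lra.
have rN : Num.sqrt (m r r) <= N.
  by rewrite ler_wsqrtr// /N2; have := a_ge0 w; have := dd_ge0 w; lra.
pose al := Num.sqrt (a u u); pose pi := Num.sqrt (m p p).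
have al_ge0 : 0 <= al := sqrtr_ge0 _.
have pi_ge0 : 0 <= pi := sqrtr_ge0 _.
have pbound : pi <= (al + 2 * N) / gamma.
  rewrite ler_pdivlMr// mulrC; apply: infsup; first by rewrite addr_ge0// mulr_ge0.
  move=> v; set nv := Num.sqrt _.
  have vn : Num.sqrt (a v v) <= nv by rewrite ler_wsqrtr// lerDl.
  have dvn : Num.sqrt (dd v v) <= nv by rewrite ler_wsqrtr// lerDr.
  have := eqV v.
  have /ler_normlP[h1 _] := form_CS_sqrt sa a_ge0 u v.
  have /ler_normlP[_ h2] := form_CS_sqrt sa a_ge0 w v.
  have /ler_normlP[_ h3] := form_CS_sqrt sdd dd_ge0 w v.
  have : Num.sqrt (a u u) * Num.sqrt (a v v) <= al * nv by rewrite ler_wpM2l.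
  have : Num.sqrt (a w w) * Num.sqrt (a v v) <= N * nv by rewrite ler_pM// sqrtr_ge0.
  have : Num.sqrt (dd w w) * Num.sqrt (dd v v) <= N * nv by rewrite ler_pM// sqrtr_ge0.
  lra.
have alpha : al ^+ 2 <= N * pi + N * al + N * N.
  rewrite sqr_sqrtr//; have := eqV u; rewrite eqQ.
  have /ler_normlP[h1 _] := form_CS_sqrt sm m_ge0 r p.
  have /ler_normlP[_ h2] := form_CS_sqrt sa a_ge0 w u.
  have /ler_normlP[_ h3] := form_CS_sqrt sdd dd_ge0 w u.
  have : Num.sqrt (m r r) * Num.sqrt (m p p) <= N * pi by rewrite ler_wpM2r.
  have : Num.sqrt (a w w) * Num.sqrt (a u u) <= N * al by rewrite ler_wpM2r.
  have : Num.sqrt (dd w w) * Num.sqrt (dd u u) <= N * N.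
    by rewrite ddu ler_pM// sqrtr_ge0.
  lra.
set g := gamma^-1 in pbound *.
have g_ge0 : 0 <= g by rewrite invr_ge0 ltW.
have al_le : al <= (2 + 2 * g) * N.
  rewrite leNgt; apply/negP => al_gt.
  have := ler_wpM2l N_ge0 pbound.
  have := ler_wpM2l N_ge0 (ltW al_gt).
  have : 0 < al by apply: le_lt_trans al_gt; rewrite mulr_ge0// addr_ge0// mulr_ge0.
  have := mulr_ge0 g_ge0 N_ge0.
  nra.
have pi_le : pi <= ((4 + 2 * g) * g) * N.
  apply: le_trans pbound _; rewrite -mulrA [g * N]mulrC mulrA ler_wpM2r//.
  by lra.
rewrite -(sqr_sqrtr (a_ge0 u)) -(sqr_sqrtr (m_ge0 p)) -/al -/pi.
have -> : N2 = N ^+ 2 by rewrite sqr_sqrtr.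
rewrite /stability_constant -/g [leRHS]mulrDl [X in _ <= X + _]mulrDl mul1r.
rewrite -!exprMn lerD ?lerD//.
- by rewrite lerXn2r ?nnegrE// mulr_ge0// addr_ge0// mulr_ge0.
- by rewrite -(sqr_sqrtr (m_ge0 r)) lerXn2r ?nnegrE// sqrtr_ge0.
- by rewrite lerXn2r ?nnegrE// mulr_ge0// mulr_ge0// addr_ge0// mulr_ge0.
Qed.

End saddle_point.

(** * Measurability of open sets *)

Section open_sets.
Context {R : realType} {d : nat}.
Local Notation E := 'rV[R]_d.

Lemma measurable_entry (j : 'I_d) (D : set E) :
  measurable_fun D (fun x : E => x 0 j : R).
Proof.
move=> mD B mB; apply: measurableI => //; apply: sub_sigma_algebra.
by exists 0, j, B.
Qed.

Definition box (q : 'rV[R]_d) (r : R) : set E :=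
  [set x | forall j, ball (q 0 j) r (x 0 j)].

Lemma measurable_box q r : measurable (box q r).
Proof.
have -> : box q r = \big[setI/setT]_(j < d)
    ((fun x : E => x 0 j : R) @^-1` ball (q 0 j) r).
  rewrite -bigcap_seq; apply/seteqP; split => [x xq j _|x xq j]; first exact: xq.
  by apply: xq => //=; rewrite mem_index_enum.
apply: bigsetI_measurable => j _.
by rewrite -[X in measurable X]setTI; apply: measurable_entry => //; exact: measurable_ball.
Qed.

(** Every point of an open set lies in a box with rational data contained in
    that set, and there are countably many such boxes. *)
Lemma open_measurable_rV (U : set E) : open U -> measurable U.
Proof.
move=> oU.
pose F (p : 'rV[rat]_d * rat) : set E :=
  let B := box (map_mx ratr p.1) (ratr p.2) in
  if `[< B `<=` U >] then B else set0.
suff -> : U = \bigcup_p F p.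
  apply: countable_bigcupT_measurable => [|p]; first exact: countableP.
  by rewrite /F; case: ifP => _ //; exact: measurable_box.
apply/seteqP; split=> [x Ux|x [p _]]; last first.
  by rewrite /F; case: ifPn => // /asboolP pU /pU.
move: (oU); rewrite openE => /(_ x Ux) /nbhs_ballP[e /= e0 eU].
have [r] : exists r : rat, ratr r \in `]0, (e / 2)[%R.
  by apply: rat_in_itvoo; rewrite divr_gt0.
rewrite in_itv/= => /andP[r0 re].
have qE (j : 'I_d) : exists q : rat, ratr q \in `]x 0 j, (x 0 j + ratr r)[%R.
  by apply: rat_in_itvoo; rewrite ltrDl.
have [q qP] := choice qE.
exists (\row_j q j, r) => //; rewrite /F ifT/=.
  move=> j; rewrite !mxE; move: (qP j); rewrite in_itv/= => /andP[h1 h2].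
  by rewrite /ball /= ltr_distlC; apply/andP; split; lra.
apply/asboolP => y yq; apply: eU; split=> // i j; rewrite ord1.
have := yq j; move: (qP j); rewrite !mxE in_itv/= => /andP[h1 h2].
rewrite /ball /= !ltr_distlC => /andP[h3 h4]; apply/andP; split; lra.
Qed.

End open_sets.

(** * Integrals and almost everywhere relations *)

Section almost_everywhere.
Context {d : measure_display} {T : measurableType d} {R : realType}.
Context {mu : {measure set T -> \bar R}} {D : set T}.
Hypothesis mD : measurable D.
Implicit Types f g : T -> R.

Lemma ae_eq_Rintegral f g : measurable_fun D f -> measurable_fun D g ->
  {ae mu, forall x, D x -> f x = g x} ->
  \int[mu]_(x in D) f x = \int[mu]_(x in D) g x.
Proof.
move=> mf mg fg; congr fine; apply: ae_eq_integral => //.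
- exact/measurable_EFinP.
- exact/measurable_EFinP.
- by apply: filterS fg => x fg /fg ->.
Qed.

Lemma integrable_ae_le f g : measurable_fun D f -> mu.-integrable D (EFin \o g) ->
  {ae mu, forall x, D x -> `|f x| <= g x} -> mu.-integrable D (EFin \o f).
Proof.
move=> mf ig fg; have mg := measurable_int _ ig.
apply/integrableP; split; first exact/measurable_EFinP.
move/integrableP : (ig) => [_]; apply: le_lt_trans.
apply: ae_ge0_le_integral => //.
- by apply: measurableT_comp => //; exact/measurable_EFinP.
- exact: measurableT_comp.
- by apply: filterS fg => x fg /fg /= fgx; rewrite lee_fin (le_trans fgx)// ler_norm.
Qed.

Lemma integrable_ae_eq f g : measurable_fun D f -> mu.-integrable D (EFin \o g) ->
  {ae mu, forall x, D x -> f x = g x} -> mu.-integrable D (EFin \o f).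
Proof.
move=> mf ig fg; apply: (@integrable_ae_le _ (fun x => `|g x|)) => //.
  exact: (integrable_abse ig).
by apply: filterS fg => x fg /fg ->.
Qed.

Lemma ae_le_Rintegral f g :
  mu.-integrable D (EFin \o f) -> mu.-integrable D (EFin \o g) ->
  {ae mu, forall x, D x -> f x <= g x} ->
  \int[mu]_(x in D) f x <= \int[mu]_(x in D) g x.
Proof.
move=> fi gi fg; rewrite -subr_ge0 -RintegralB//.
have mgf : measurable_fun D (fun x => g x - f x).
  apply: measurable_funB; apply/measurable_EFinP.
    exact: (measurable_int _ gi).
  exact: (measurable_int _ fi).
rewrite (ae_eq_Rintegral (fun x => g x - f x) (fun x => `|g x - f x|))//.
- by apply: Rintegral_ge0.
- exact: measurableT_comp.
- by apply: filterS fg => x fg /fg fgx; rewrite ger0_norm// subr_ge0.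
Qed.

Lemma Rintegral_linear k f g :
  mu.-integrable D (EFin \o f) -> mu.-integrable D (EFin \o g) ->
  \int[mu]_(x in D) (k * f x + g x) =
  k * \int[mu]_(x in D) f x + \int[mu]_(x in D) g x.
Proof.
move=> fi gi; rewrite RintegralD//; first by rewrite RintegralZl.
exact: (integrableZl mD k fi).
Qed.

Lemma Rintegral_eq0_ae f : mu.-integrable D (EFin \o f) ->
  (forall x, 0 <= f x) -> \int[mu]_(x in D) f x = 0 ->
  {ae mu, forall x, D x -> f x = 0}.
Proof.
move=> fi f0 If.
have : (\int[mu]_(x in D) `|(EFin \o f) x| = 0)%E.
  transitivity ((\int[mu]_(x in D) f x)%:E); last by rewrite If.
  rewrite /Rintegral fineK; last exact: integrable_fin_num.
  by apply: eq_integral => x _; rewrite /= ger0_norm.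
move/(ae_eq_integral_abs mu mD (measurable_int _ fi)).
by apply: filterS => x xf /xf [].
Qed.

End almost_everywhere.

(** * Pointwise bounds for the inverse of an elliptic tensor *)

Section tensors.
Context {R : realType} {d : nat}.
Local Notation E := 'rV[R]_d.
Implicit Types (K : 'M[R]_d) (u v : E).

Definition tensor_form K u v : R := edot (K *m u^T)^T v.

Lemma edot_symmetric : is_symmetric (@edot R d).
Proof.
have eC u v : edot u v = edot v u.
  by apply: eq_bigr => i _; rewrite mulrC.
have el v : forall k u u', edot (k *: u + u') v = k * edot u v + edot u' v.
  move=> k u u'; rewrite /edot mulr_sumr -big_split; apply: eq_bigr => i _ /=.
  by rewrite !mxE; ring.
split=> //; split=> [v|u]; apply: linear_formP => k w w'; first exact: el.
by rewrite eC el !(eC u).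
Qed.

Lemma edot_ge0 u : 0 <= edot u u.
Proof. by apply: sumr_ge0 => i _; rewrite -expr2 sqr_ge0. Qed.

Lemma edot_eq0 u : edot u u = 0 -> u = 0.
Proof.
move=> /eqP; rewrite psumr_eq0 => [/allP u0|i _]; last by rewrite -expr2 sqr_ge0.
apply/rowP => i; apply/eqP; have := u0 i (mem_index_enum _).
by rewrite mxE -expr2 sqrf_eq0.
Qed.

Lemma enormE u : enorm u ^+ 2 = edot u u.
Proof. by rewrite sqr_sqrtr// edot_ge0. Qed.

Lemma edot_mulmx K u v : edot (K *m u^T)^T v = edot u (K^T *m v^T)^T.
Proof.
have dotE w z : edot w z = (w *m z^T) 0 0.
  by rewrite !mxE; apply: eq_bigr => i _; rewrite mxE.
by rewrite !dotE trmxK trmx_mul !trmxK mulmxA.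
Qed.

Lemma tensor_form_symmetric K : K^T = K -> is_symmetric (tensor_form K).
Proof.
move=> KT; have be := edot_symmetric.1.
split=> [|u v]; last by rewrite /tensor_form edot_mulmx KT edot_symmetric.2.
split=> [v|u]; apply: linear_formP => k w w'; last exact: (bilPr be).
by rewrite /tensor_form !linearP /=; exact: (bilPl be).
Qed.

Context {k1 k2 : R} {K : 'M[R]_d}.
Hypotheses (k1_gt0 : 0 < k1) (k2_gt0 : 0 < k2) (KT : K^T = K).
Hypothesis K_ge : forall u, k1 * edot u u <= tensor_form K u u.
Hypothesis K_le : forall u, tensor_form K u u <= k2 * edot u u.

Let tK_ge0 u : 0 <= tensor_form K u u.
Proof. by apply: le_trans (K_ge u); rewrite mulr_ge0 ?edot_ge0// ltW. Qed.

Lemma elliptic_unitmx : K \in unitmx.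
Proof.
rewrite -row_free_unit; apply: inj_row_free => v vK.
apply: edot_eq0; apply/eqP; rewrite eq_le edot_ge0 andbT.
have := K_ge v; rewrite /tensor_form -KT -trmx_mul vK trmx0 trmx0.
by rewrite (bil0l edot_symmetric.1) pmulr_rle0.
Qed.

Let Kinv u := (invmx K *m u^T)^T.

Let tensor_form_inv u v : tensor_form K (Kinv u) v = edot u v.
Proof. by rewrite /tensor_form /Kinv trmxK mulmxA mulmxV ?elliptic_unitmx// mul1mx trmxK. Qed.

Let inv_ge0 u : 0 <= edot u (Kinv u).
Proof. by rewrite -tensor_form_inv. Qed.

Lemma invmx_form_symmetric : is_symmetric (tensor_form (invmx K)).
Proof. by apply: tensor_form_symmetric; rewrite trmx_inv KT. Qed.

Let invE u v : tensor_form (invmx K) u v = edot v (Kinv u).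
Proof. by rewrite edot_symmetric.2. Qed.

Lemma invmx_form_ge0 u : 0 <= tensor_form (invmx K) u u.
Proof. by rewrite invE. Qed.

(** With w = K^-1 u one has k1 |w|^2 <= w . K w = u . w and
    (u . w)^2 <= |u|^2 |w|^2. *)
Lemma invmx_form_le u : tensor_form (invmx K) u u <= k1^-1 * edot u u.
Proof.
rewrite invE; have := form_CS edot_symmetric edot_ge0 u (Kinv u).
have := K_ge (Kinv u); rewrite tensor_form_inv.
have := inv_ge0 u; have := edot_ge0 u; have := edot_ge0 (Kinv u).
move: (edot u u) (edot u (Kinv u)) (edot (Kinv u) (Kinv u)) => a b c c0 a0 b0 kcb bac.
rewrite mulrC ler_pdivlMr//.
move: b0; rewrite le_eqVlt => /orP[/eqP <-|b0]; first by rewrite mul0r.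
rewrite -(ler_pM2l b0).
have := ler_wpM2l a0 kcb; have := ler_wpM2l (ltW k1_gt0) bac; lra.
Qed.

(** With w = K^-1 u, the Cauchy-Schwarz inequality of K reads
    (u . u)^2 = (K w . u)^2 <= (u . w) (K u . u). *)
Lemma invmx_form_ge u : edot u u <= k2 * tensor_form (invmx K) u u.
Proof.
rewrite invE; have := form_CS (tensor_form_symmetric _ KT) tK_ge0 (Kinv u) u.
have := K_le u; rewrite !tensor_form_inv.
have := inv_ge0 u; have := edot_ge0 u; have := tK_ge0 u.
move: (edot u u) (edot u (Kinv u)) (tensor_form K u u) => a b c c0 a0 b0 cka abc.
move: a0; rewrite le_eqVlt => /orP[/eqP <-|a0].
  by rewrite mulr_ge0// ltW.
rewrite -(ler_pM2l a0).
have := ler_wpM2l b0 cka; lra.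
Qed.

Lemma invmx_form_bound u v :
  `|tensor_form (invmx K) u v| <= k1^-1 * (edot u u + edot v v).
Proof.
apply: le_trans (form_CS_sqrt invmx_form_symmetric invmx_form_ge0 u v) _.
have := invmx_form_le u; have := invmx_form_le v.
rewrite -{1}(sqr_sqrtr (invmx_form_ge0 u)) -{1}(sqr_sqrtr (invmx_form_ge0 v)).
have := sqr_ge0 (Num.sqrt (tensor_form (invmx K) u u) - Num.sqrt (tensor_form (invmx K) v v)).
have k1V : 0 < k1^-1 by rewrite invr_gt0.
have := mulr_ge0 (ltW k1V) (edot_ge0 u); have := mulr_ge0 (ltW k1V) (edot_ge0 v).
nra.
Qed.

End tensors.

(** * Measurability of the inverse matrix *)

Section measurable_inverse.
Context {disp : measure_display} {T : measurableType disp} {R : realType}.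
Context {D : set T}.
Hypothesis mD : measurable D.

Lemma measurable_funV (f : T -> R) :
  measurable_fun D f -> measurable_fun D (fun x => (f x)^-1).
Proof.
move=> mf.
(* this reduces inverses to powers of nonnegative reals *)
have -> : (fun x => (f x)^-1) = (fun x => f x * ((f x ^+ 2) `^ (-1))).
  apply/funext => x; rewrite powR_inv1 ?sqr_ge0//.
  have [->|fx0] := eqVneq (f x) 0; first by rewrite invr0 mul0r.
  by rewrite expr2 invfM mulrA mulfV// mul1r.
apply: measurable_funM => //.
by apply: (measurableT_comp (measurable_powR (R := R) (-1))); exact: measurable_funX.
Qed.

Lemma measurable_det {n} (M : T -> 'M[R]_n) :
  (forall i j, measurable_fun D (fun x => M x i j)) ->
  measurable_fun D (fun x => \det (M x)).
Proof.
move=> mM; apply: measurable_sum => s; apply: measurable_funM => //.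
by apply: measurable_prod => i _.
Qed.

Lemma measurable_invmx {n} (M : T -> 'M[R]_n) i j :
  (forall i j, measurable_fun D (fun x => M x i j)) ->
  measurable_fun D (fun x => invmx (M x) i j).
Proof.
move=> mM; have mdet := measurable_det M mM.
have -> : (fun x => invmx (M x) i j) = (fun x => if \det (M x) == 0 then M x i j
    else (\det (M x))^-1 * ((-1) ^+ (j + i) * \det (row' j (col' i (M x))))).
  apply/funext => x; rewrite /invmx unitmxE unitfE.
  by case: eqP => //= _; rewrite !mxE.
apply: measurable_fun_if => //.
- apply: measurable_fun_eqr; [exact: mdet|exact: measurable_cst].
- by apply: (measurable_funS mD) (mM i j); exact: subIsetl.
- apply: (measurable_funS mD); first exact: subIsetl.
  apply: measurable_funM; first exact: measurable_funV.
  apply: measurable_funM; first exact: measurable_cst.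
  apply: measurable_det => k l.
  rewrite (_ : (fun _ => _) = (fun x => M x (lift j k) (lift i l)))//.
  by apply/funext => x; rewrite !mxE.
Qed.

End measurable_inverse.

(** * Inner products of square integrable functions *)

Section square_integrable.
Context {R : realType} {d : nat} {Omega : set 'rV[R]_d}.
Local Notation E := 'rV[R]_d.
Local Notation mu := (@lebesgue_rv R d).
Hypothesis mOmega : measurable Omega.
Implicit Types (f g : E -> R) (u v : E -> E).

Lemma L2_measurable f : L2 Omega f -> measurable_fun Omega f.
Proof.
move=> L2f; apply/measurable_restrictT => //.
by move: L2f; rewrite /L2 => /[!inE] /andP[/[!inE]].
Qed.

Lemma L2_integrable_mul f g : L2 Omega f -> L2 Omega g ->
  mu.-integrable Omega (EFin \o (fun x => f x * g x)).
Proof.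
move=> L2f L2g; apply/(integrable_mkcond _ mOmega).
have /Lfun1_integrable := Lfun2_mul_Lfun1 L2f L2g.
apply: eq_integrable => // x _ /=.
by rewrite !patchE; case: ifP => //=; rewrite mulr0.
Qed.

Lemma ipC f g : ip Omega f g = ip Omega g f.
Proof. by apply: eq_Rintegral => x _; rewrite mulrC. Qed.

Lemma ip_ge0 f : 0 <= ip Omega f f.
Proof. by apply: Rintegral_ge0 => x _; rewrite -expr2 sqr_ge0. Qed.

Lemma ip_eq0 f : L2 Omega f -> ip Omega f f = 0 ->
  ae_eq_on Omega f (fun=> 0).
Proof.
move=> L2f f0; have := Rintegral_eq0_ae mOmega _ (L2_integrable_mul _ _ L2f L2f).
move=> /(_ (fun x => sqr_ge0 (f x)) f0).
by apply: filterS => x fx /fx /eqP; rewrite -expr2 sqrf_eq0 => /eqP.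
Qed.

Lemma ip_bilinear {W Z : lmodType R} (f : W -> E -> R) (g : Z -> E -> R) :
  (forall k w w' x, f (k *: w + w') x = k * f w x + f w' x) ->
  (forall k z z' x, g (k *: z + z') x = k * g z x + g z' x) ->
  (forall w, L2 Omega (f w)) -> (forall z, L2 Omega (g z)) ->
  is_bilinear (fun w z => ip Omega (f w) (g z)).
Proof.
move=> fl gl L2f L2g; split=> [z|w]; apply: linear_formP => k y y';
  rewrite /ip -(Rintegral_linear mOmega) ?L2_integrable_mul//;
  apply: eq_Rintegral => x _; rewrite ?fl ?gl; ring.
Qed.

Lemma edot_integrable u : L2v Omega u ->
  mu.-integrable Omega (EFin \o (fun x => edot (u x) (u x))).
Proof.
move=> L2u.
rewrite (_ : _ \o _ = (fun x => \sum_(i < d) (u x 0 i * u x 0 i)%:E)%E).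
  by apply: integrable_sum => // i _; exact: L2_integrable_mul.
by apply/funext => x; rewrite /= sumEFin.
Qed.

Lemma ipv_eq0 u : L2v Omega u -> ipv Omega u u = 0 -> ae_eq_on Omega u (fun=> 0).
Proof.
move=> L2u u0; have := Rintegral_eq0_ae mOmega _ (edot_integrable _ L2u).
move=> /(_ (fun x => edot_ge0 (u x)) u0).
by apply: filterS => x ux /ux /edot_eq0.
Qed.

(** A function e with zero mean does not see the constant c. If c is nonzero, then
    e is integrable because c e agrees with e (f - g), a combination of products
    of square integrable functions. *)
Lemma ip_add_constant e f g c : L2 Omega e -> L2 Omega f -> L2 Omega g ->
  ae_eq_on Omega f (fun x => g x + c) -> ip Omega e (fun=> 1) = 0 ->
  ip Omega e f = ip Omega e g.
Proof.
move=> L2e L2f L2g fg e1.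
have me := L2_measurable _ L2e.
have mec : measurable_fun Omega (fun x => c * e x).
  by apply: measurable_funM => //; exact: measurable_cst.
have int_ef := L2_integrable_mul _ _ L2e L2f.
have int_eg := L2_integrable_mul _ _ L2e L2g.
have int_efg : mu.-integrable Omega (EFin \o (fun x => e x * f x - e x * g x)).
  exact: (integrableB mOmega int_ef int_eg).
have efg : {ae mu, forall x, Omega x -> c * e x = e x * f x - e x * g x}.
  by apply: filterS fg => x fg /fg ->; ring.
have int_ec := integrable_ae_eq mOmega _ _ mec int_efg efg.
apply/eqP; rewrite -subr_eq0 -RintegralB//.
have mfg : measurable_fun Omega (fun x => e x * f x - e x * g x).
  by apply/measurable_EFinP; exact: (measurable_int _ int_efg).
rewrite -(ae_eq_Rintegral mOmega _ _ mec mfg efg).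
have [->|c0] := eqVneq c 0.
  under eq_Rintegral do rewrite mul0r.
  by rewrite Rintegral_cst// mul0r.
have int_e : mu.-integrable Omega (EFin \o e).
  have := integrableZl mOmega c^-1 int_ec.
  by apply: eq_integrable => // x _ /=; rewrite -EFinM mulrA mulVf// mul1r.
rewrite RintegralZl//; apply/eqP; rewrite [X in _ * X](_ : _ = 0) ?mulr0//.
by rewrite -[RHS]e1; apply: eq_Rintegral => x _; rewrite mulr1.
Qed.

Definition permeability_form (K : E -> 'M[R]_d) u v : R :=
  ipv Omega (fun x => (invmx (K x) *m (u x)^T)^T) v.

Section permeability.
Context {k1 k2 : R} {K : E -> 'M[R]_d}.
Hypotheses (k1_gt0 : 0 < k1) (k2_gt0 : 0 < k2).
Hypothesis mK : forall i j, measurable_fun Omega (fun x => K x i j).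
Hypothesis K_elliptic : {ae mu, forall x, Omega x -> (K x)^T = K x /\
  forall xi : E, k1 * edot xi xi <= tensor_form (K x) xi xi <= k2 * edot xi xi}.

Let F u v x := tensor_form (invmx (K x)) (u x) (v x).

Let measurable_F u v : L2v Omega u -> L2v Omega v -> measurable_fun Omega (F u v).
Proof.
move=> L2u L2v; apply: measurable_sum => i; apply: measurable_funM; last first.
  exact: L2_measurable.
rewrite (_ : (fun _ => _) = fun x => \sum_j invmx (K x) i j * u x 0 j).
  apply: measurable_sum => j; apply: measurable_funM; last exact: L2_measurable.
  exact: measurable_invmx.
by apply/funext => x; rewrite !mxE; apply: eq_bigr => j _; rewrite mxE.
Qed.

Lemma permeability_integrable u v : L2v Omega u -> L2v Omega v ->
  mu.-integrable Omega (EFin \o F u v).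
Proof.
move=> L2u L2v.
apply: (integrable_ae_le mOmega _
  (fun x => k1^-1 * (edot (u x) (u x) + edot (v x) (v x)))).
- exact: measurable_F.
- have int_uv := integrableD mOmega (edot_integrable _ L2u) (edot_integrable _ L2v).
  exact: (integrableZl mOmega k1^-1 int_uv).
- apply: filterS K_elliptic => x Kx /Kx[KT Kb].
  by apply: (invmx_form_bound k1_gt0 KT) => xi; have /andP[] := Kb xi.
Qed.

Lemma permeability_form_symmetric {W : lmodType R} (f : W -> E -> E) :
  (forall k w w' x, f (k *: w + w') x = k *: f w x + f w' x) ->
  (forall w, L2v Omega (f w)) ->
  is_symmetric (fun w z => permeability_form K (f w) (f z)).
Proof.
move=> fl L2f; have be := (@edot_symmetric R d).1; split.
  split=> [z|w]; apply: linear_formP => k y y'; rewrite /permeability_form /ipv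
    -(Rintegral_linear mOmega) ?permeability_integrable//;
    apply: eq_Rintegral => x _; rewrite fl.
    by rewrite !linearP /= (bilPl be).
  by rewrite (bilPr be).
move=> w z; apply: ae_eq_Rintegral => //; [exact: measurable_F..|].
apply: filterS K_elliptic => x Kx /Kx[KT Kb].
exact: (invmx_form_symmetric KT).2.
Qed.

Lemma permeability_form_le u : L2v Omega u ->
  permeability_form K u u <= k1^-1 * ipv Omega u u.
Proof.
move=> L2u; rewrite /ipv -RintegralZl//; last exact: edot_integrable.
apply: ae_le_Rintegral => //; first exact: permeability_integrable.
  exact: (integrableZl mOmega k1^-1 (edot_integrable _ L2u)).
apply: filterS K_elliptic => x Kx /Kx[KT Kb].
by apply: (invmx_form_le k1_gt0 KT) => xi; have /andP[] := Kb xi.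
Qed.

Lemma permeability_form_ge u : L2v Omega u ->
  ipv Omega u u <= k2 * permeability_form K u u.
Proof.
move=> L2u; rewrite /permeability_form /ipv -RintegralZl//; last first.
  exact: permeability_integrable.
apply: ae_le_Rintegral => //; first exact: edot_integrable.
  exact: (integrableZl mOmega k2 (permeability_integrable _ _ L2u L2u)).
apply: filterS K_elliptic => x Kx /Kx[KT Kb].
by apply: (invmx_form_ge k1_gt0 k2_gt0 KT) => xi; have /andP[] := Kb xi.
Qed.

Lemma permeability_form_ge0 u : L2v Omega u -> 0 <= permeability_form K u u.
Proof.
move=> L2u; rewrite -(pmulr_rge0 _ k2_gt0); apply: le_trans (permeability_form_ge _ L2u).
by apply: Rintegral_ge0 => x _; exact: edot_ge0.
Qed.

Lemma permeability_form_eq0 u : L2v Omega u -> permeability_form K u u = 0 ->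
  ae_eq_on Omega u (fun=> 0).
Proof.
move=> L2u u0; apply: ipv_eq0 => //; apply/eqP; rewrite eq_le; apply/andP; split.
  by have := permeability_form_ge _ L2u; rewrite u0 mulr0.
by apply: Rintegral_ge0 => x _; exact: edot_ge0.
Qed.

End permeability.

End square_integrable.

(** The zero normal trace, tested with the constant function 1. *)
Lemma Hdiv0_mean {R : realType} {d : nat} (Omega : set 'rV[R]_d) u g :
  Hdiv0 Omega u g -> ip Omega g (fun=> 1) = 0.
Proof.
move=> [_ /(_ (fun=> 1))].
have Dcst c i : partial i (fun=> c : R) = (fun=> 0) :> ('rV[R]_d -> R).
  by apply/funext => x; rewrite /partial derive_cst.
have cst_continuous c : continuous ((fun=> c) : 'rV[R]_d -> R).
  by move=> x; apply: cvg_cst; exact: (nbhs_filter x).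
have smooth1 : smooth ((fun=> 1) : 'rV[R]_d -> R).
  move=> k; elim: k (1 : R) => [|k IH] c; first exact: cst_continuous.
  split=> [|i]; first exact: cst_continuous.
  by split; [move=> x; exact: derivable_cst|rewrite Dcst; exact: IH].
move=> /(_ smooth1); rewrite /normal_trace.
rewrite [X in X + _](_ : _ = 0) ?add0r//.
rewrite /ipv; under eq_Rintegral => x _.
  rewrite (_ : grad _ _ = 0); last by apply/rowP => i; rewrite !mxE Dcst.
  rewrite (bil0r edot_symmetric.1).
  over.
by rewrite /Rintegral integral0.
Qed.

(** If k1 and k2 are not both positive, then the bounds fail at every
    point, so that the domain is negligible and any constants will do. *)
Lemma elliptic_constants {R : realType} {d : nat} (Omega : set 'rV[R]_d) k1 k2 K :
  (0 < d)%N -> elliptic Omega k1 k2 K ->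
  exists l1 l2 : R, [/\ 0 < l1, 0 < l2 &
    {ae @lebesgue_rv R d, forall x, Omega x -> (K x)^T = K x /\
      forall xi : 'rV[R]_d,
        l1 * edot xi xi <= tensor_form (K x) xi xi <= l2 * edot xi xi}].
Proof.
move=> d_gt0 [_ K_elliptic].
have [/andP[k1_gt0 k2_gt0]|k_le0] := boolP ((0 < k1) && (0 < k2)).
  exists k1, k2; split=> //; apply: filterS K_elliptic => x Kx /Kx[KT Kb].
  split=> // xi; have [->|xi0] := eqVneq xi 0.
    by rewrite /tensor_form trmx0 mulmx0 trmx0 !(bil0l edot_symmetric.1) !mulr0 lexx.
  have := Kb xi^T; rewrite !trmxK enormE trmx_eq0 => /(_ xi0)[_ h1 h2].
  by rewrite /tensor_form h1 h2.
exists 1, 1; split=> //; apply: filterS K_elliptic => x Kx /Kx[KT Kb].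
exfalso; pose xi : 'rV[R]_d := const_mx 1.
have xi0 : xi != 0.
  apply/eqP => /rowP/(_ (Ordinal d_gt0)); rewrite !mxE.
  by apply/eqP; exact: oner_neq0.
have := Kb xi^T; rewrite !trmxK enormE trmx_eq0 => /(_ xi0)[h0 h1 h2].
have xi_gt0 : 0 < edot xi xi.
  by rewrite lt_def edot_ge0 andbT; apply: contra_neq xi0; exact: edot_eq0.
move: k_le0; rewrite negb_and -!leNgt => /orP[] k_le0.
  by move: h0; rewrite pmulr_lgt0// ltNge k_le0.
have := lt_le_trans (lt_le_trans h0 h1) h2.
by rewrite pmulr_lgt0// ltNge k_le0.
Qed.

(** * The Darcy operators *)

Section blocks.
Context {R : realType} {X Y : vectType R}.

Lemma blockE (A : 'Hom(X, dual_space X)) (Bt : 'Hom(Y, dual_space X))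
    (B : 'Hom(X, dual_space Y)) (D : 'Hom(Y, dual_space Y)) (x y : X * Y) :
  pairing (block A Bt B D x) y =
    pairing (A x.1) y.1 + pairing (Bt x.2) y.1 +
    pairing (B x.1) y.2 + pairing (D x.2) y.2.
Proof.
pose F (x y : X * Y) := pairing (A x.1) y.1 + pairing (Bt x.2) y.1 +
    pairing (B x.1) y.2 + pairing (D x.2) y.2.
have [bA bBt] := (pairing_bilinear A, pairing_bilinear Bt).
have [bB bD] := (pairing_bilinear B, pairing_bilinear D).
apply: (@operE _ _ _ F).
  move=> [y1 y2]; apply: linear_formP => k [x1 x2] [x1' x2']; rewrite /F /=.
  by rewrite (bilPl bA) (bilPl bBt) (bilPl bB) (bilPl bD); ring.
move=> [x1 x2]; apply: linear_formP => k [y1 y2] [y1' y2']; rewrite /F /=.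
by rewrite (bilPr bA) (bilPr bBt) (bilPr bB) (bilPr bD); ring.
Qed.

Lemma adjointE (B : 'Hom(X, dual_space Y)) x y :
  pairing (adjoint B y) x = pairing (B x) y.
Proof.
have bB := pairing_bilinear B.
by apply: (@operE _ _ _ (fun y x => pairing (B x) y)) => [x'|y'];
  apply: linear_formP => k z z'; [exact: (bilPr bB)|exact: (bilPl bB)].
Qed.

End blocks.

Definition darcy_stability {R : realType} (k1 beta : R) : R :=
  stability_constant (beta / Num.sqrt (k1^-1 + 1)).

Section darcy_discretization.
Context {R : realType} {d : nat}.
Context {Omega : set 'rV[R]_d} {k1 k2 : R} {K : 'rV[R]_d -> 'M[R]_d}.
Context {sigma h beta : R} {D : discretization R d}.
Local Notation E := 'rV[R]_d.
Local Notation mu := (@lebesgue_rv R d).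
Local Notation V := (subvs_of (Hh0 D)).
Local Notation Q := (Lh0 D).
Hypotheses (mOmega : measurable Omega) (k1_gt0 : 0 < k1) (k2_gt0 : 0 < k2).
Hypothesis mK : forall i j, measurable_fun Omega (fun x => K x i j).
Hypothesis K_elliptic : {ae mu, forall x, Omega x -> (K x)^T = K x /\
  forall xi : E, k1 * edot xi xi <= tensor_form (K x) xi xi <= k2 * edot xi xi}.
Hypotheses (hD : discretization_of Omega sigma h D) (beta_gt0 : 0 < beta).
Hypothesis h_inf_sup : inf_sup Omega beta D.
Hypothesis h_div : forall u : Hh D, Lh Omega D (dvg u).

Definition darcy_a (u v : V) : R :=
  permeability_form (Omega := Omega) K (fld (vsval u)) (fld (vsval v)).
Definition darcy_d (u v : V) : R := ip Omega (dvg (vsval u)) (dvg (vsval v)).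
Definition darcy_m (p q : Q) : R := ip Omega (sca p) (sca q).
Definition darcy_b (u : V) (q : Q) : R := - ip Omega (dvg (vsval u)) (sca q).

Let L2fld (u : V) : L2v Omega (fld (vsval u)).
Proof. by have [] := Hh_Hdiv hD (vsval u). Qed.

Let L2dvg (u : V) : L2 Omega (dvg (vsval u)).
Proof. by have [] := Hh_Hdiv hD (vsval u). Qed.

Let fldP k (u v : V) x :
  fld (vsval (k *: u + v)) x = k *: fld (vsval u) x + fld (vsval v) x.
Proof. by rewrite [vsval _]linearP linearP. Qed.

Let dvgP k (u v : V) x :
  dvg (vsval (k *: u + v)) x = k * dvg (vsval u) x + dvg (vsval v) x.
Proof. by rewrite [vsval _]linearP linearP. Qed.

Let scaP k (p q : Q) x : sca (k *: p + q) x = k * sca p x + sca q x.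
Proof. by rewrite linearP. Qed.

Lemma darcy_a_symmetric : is_symmetric darcy_a.
Proof.
exact: (permeability_form_symmetric mOmega k1_gt0 mK K_elliptic _ fldP L2fld).
Qed.

Lemma darcy_d_symmetric : is_symmetric darcy_d.
Proof.
split; last by move=> u v; exact: ipC.
exact: (ip_bilinear mOmega _ _ dvgP dvgP L2dvg L2dvg).
Qed.

Lemma darcy_m_symmetric : is_symmetric darcy_m.
Proof.
split; last by move=> p q; exact: ipC.
exact: (ip_bilinear mOmega _ _ scaP scaP (Lh0_L2 hD) (Lh0_L2 hD)).
Qed.

Lemma darcy_b_bilinear : is_bilinear darcy_b.
Proof.
have := ip_bilinear mOmega _ _ dvgP scaP L2dvg (Lh0_L2 hD) => bb.
by split=> [q|u]; apply: linear_formP => k z z'; rewrite /darcy_b;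
  [rewrite (bilPl bb)|rewrite (bilPr bb)]; ring.
Qed.

Lemma darcy_a_ge0 u : 0 <= darcy_a u u.
Proof. exact: (permeability_form_ge0 mOmega k1_gt0 k2_gt0 mK K_elliptic). Qed.

Lemma darcy_a_eq0 u : darcy_a u u = 0 -> u = 0.
Proof.
move=> u0; apply: val_inj; apply: (Hh_inj hD).
exact: (permeability_form_eq0 mOmega k1_gt0 k2_gt0 mK K_elliptic _ (L2fld u) u0).
Qed.

Lemma darcy_m_eq0 q : darcy_m q q = 0 -> q = 0.
Proof. by move=> q0; apply: (Lh0_inj hD); apply: ip_eq0 => //; exact: (Lh0_L2 hD). Qed.

(** The divergence of a field with zero normal trace has zero mean, and so does
    every element of the discrete pressure space: the constant component of the
    divergence is invisible to all the integrals involved. *)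
Lemma darcy_divergence_pressure (u : V) :
  exists2 q0, forall q, darcy_b u q = darcy_m q0 q & darcy_d u u = darcy_m q0 q0.
Proof.
have [q [c divE]] := h_div (vsval u).
have L2q := Lh0_L2 hD.
have mean_div : ip Omega (dvg (vsval u)) (fun=> 1) = 0.
  exact: Hdiv0_mean ((Hh0P hD (vsval u)).1 (subvsP u)).
have divq p : ip Omega (dvg (vsval u)) (sca p) = darcy_m q p.
  rewrite /darcy_m ipC [RHS]ipC.
  exact: (ip_add_constant mOmega _ _ _ _ (L2q p) (L2dvg u) (L2q q) divE (Lh0_mean hD p)).
have bm := darcy_m_symmetric.1.
have mN p p' : darcy_m (- p) p' = - darcy_m p p'.
  by rewrite -scaleN1r (bilZl bm) mulN1r.
exists (- q) => [p|]; first by rewrite mN -divq.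
rewrite mN darcy_m_symmetric.2 mN opprK /darcy_d.
rewrite (ip_add_constant mOmega _ _ _ _ (L2dvg u) (L2dvg u) (L2q q) divE mean_div).
exact: divq.
Qed.

(** The weighted norm of v is at most the square root of k1^-1 + 1 times its norm
    in H(div). *)
Lemma darcy_inf_sup p M : 0 <= M ->
  (forall v, darcy_b v p <= M * Num.sqrt (darcy_a v v + darcy_d v v)) ->
  beta / Num.sqrt (k1^-1 + 1) * Num.sqrt (darcy_m p p) <= M.
Proof.
move=> M_ge0 bM; set kappa := k1^-1 + 1.
have k1V_gt0 : 0 < k1^-1 by rewrite invr_gt0.
have kappa_gt0 : 0 < Num.sqrt kappa by rewrite sqrtr_gt0 addr_gt0.
rewrite mulrAC ler_pdivrMr//; apply: le_trans (h_inf_sup p) _.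
have MK_ge0 : 0 <= M * Num.sqrt kappa by rewrite mulr_ge0// ltW.
set S := (X in sup X).
have SM x : S x -> x <= M * Num.sqrt kappa.
  move=> [u [uV u0] <-].
  set N := Hdiv_norm _ _ _.
  have [->|N0] := eqVneq N 0; first by rewrite invr0 mulr0.
  have N_gt0 : 0 < N by rewrite lt_def N0 sqrtr_ge0.
  rewrite ler_pdivrMr//.
  pose v : V := vsproj (Hh0 D) u.
  have vu : vsval v = u by exact: vsprojK.
  have ba := darcy_a_symmetric.1; have bd := darcy_d_symmetric.1.
  (* b has the opposite sign of the pairing with the divergence *)
  have := bM (- v); rewrite -scaleN1r (bilZl darcy_b_bilinear).
  rewrite !(bilZl ba, bilZr ba) !(bilZl bd, bilZr bd) !mulN1r /darcy_b !opprK vu.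
  move=> /le_trans; apply; rewrite -mulrA ler_wpM2l// -sqrtrM; last by rewrite ltW// addr_gt0.
  rewrite ler_wsqrtr//.
  have := permeability_form_le mOmega k1_gt0 mK K_elliptic _ (L2fld v).
  rewrite -/(darcy_a v v) /darcy_d vu /kappa.
  have := ip_ge0 (Omega := Omega) (dvg u).
  have : 0 <= ipv Omega (fld u) (fld u).
    by apply: Rintegral_ge0 => y _; exact: edot_ge0.
  move: (ipv _ _ _) (ip _ _ _) (darcy_a v v) => b c a b0 c0 ab.
  have := mulr_ge0 (ltW k1V_gt0) c0; lra.
have [->|/set0P S0] := eqVneq S set0; first by rewrite sup0.
exact: ge_sup.
Qed.

Local Notation A := (calA Omega K D).
Local Notation P := (calP Omega K D).

Lemma calAE x y : pairing (A x) y = saddle_form darcy_a darcy_b x y.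
Proof.
rewrite blockE adjointE /saddle_form /pairing !zero_lfunE addr0.
have bb := darcy_b_bilinear.
rewrite !(operE darcy_a_symmetric.1.1 darcy_a_symmetric.1.2).
by rewrite !(operE bb.1 bb.2).
Qed.

Lemma calPE x y : pairing (P x) y =
  block_diagonal_form darcy_a darcy_d darcy_m x y.
Proof.
have [ba bd bm] := And3 darcy_a_symmetric.1 darcy_d_symmetric.1 darcy_m_symmetric.1.
rewrite blockE /block_diagonal_form /pairing !(add_lfunE, zero_lfunE) !addr0.
by rewrite (operE ba.1 ba.2) (operE bd.1 bd.2) (operE bm.1 bm.2).
Qed.

Lemma calA_symmetric x y : pairing (A x) y = pairing (A y) x.
Proof. by rewrite !calAE /saddle_form darcy_a_symmetric.2; ring. Qed.

Lemma calP_symmetric x y : pairing (P x) y = pairing (P y) x.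
Proof.
rewrite !calPE /block_diagonal_form darcy_a_symmetric.2 darcy_d_symmetric.2.
by rewrite darcy_m_symmetric.2.
Qed.

Lemma calP_ge0 x : 0 <= pairing (P x) x.
Proof. by rewrite calPE !addr_ge0 ?darcy_a_ge0 ?ip_ge0. Qed.

Lemma calP_eq0 x : pairing (P x) x = 0 -> x = 0.
Proof.
rewrite calPE /block_diagonal_form; case: x => [u q] /=.
have := darcy_a_ge0 u.
have : 0 <= darcy_d u u := ip_ge0 _.
have : 0 <= darcy_m q q := ip_ge0 _.
move=> m0 d0 a0 adm0.
have [u0 q0] : darcy_a u u = 0 /\ darcy_m q q = 0.
  move: (darcy_a u u) (darcy_d u u) (darcy_m q q) m0 d0 a0 adm0 => a dd m *.
  by split; lra.
by rewrite (darcy_a_eq0 _ u0) (darcy_m_eq0 _ q0).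
Qed.

Local Notation T := (P^-1 \o A)%VF.

Lemma darcy_le x : pairing (P (T x)) (T x) <= pairing (P x) x.
Proof.
apply: (preconditioned_le1 _ _ calP_ge0 calP_eq0) => {}x y.
rewrite calAE !calPE; apply: saddle_form_le.
- exact: darcy_a_symmetric.
- exact: darcy_m_symmetric.
- exact: darcy_a_ge0.
- by move=> q; exact: ip_ge0.
- exact: darcy_divergence_pressure.
Qed.

Lemma darcy_ge x :
  (darcy_stability k1 beta)^-1 * pairing (P x) x <= pairing (P (T x)) (T x).
Proof.
have st_gt0 : 0 < darcy_stability k1 beta.
  exact: lt_le_trans ltr01 (stability_constant_ge1 _).
rewrite mulrC ler_pdivrMr// [leRHS]mulrC !calPE.
apply: saddle_form_stable.
- exact: darcy_a_symmetric.
- exact: darcy_d_symmetric.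
- exact: darcy_m_symmetric.
- exact: darcy_b_bilinear.
- exact: darcy_a_ge0.
- by move=> u; exact: ip_ge0.
- by move=> q; exact: ip_ge0.
- exact: darcy_m_eq0.
- exact: darcy_divergence_pressure.
- by rewrite divr_gt0// sqrtr_gt0 addr_gt0// invr_gt0.
- exact: darcy_inf_sup.
- by move=> y; rewrite -calAE -calPE preconditionedE//; exact: calP_eq0.
Qed.

End darcy_discretization.

(** * Uniform bounds and iteration counts *)

Theorem mainTheorem2 (R : realType) (d : nat) (hd : d = 2%N \/ d = 3%N)
  (Omega : set 'rV[R]_d) (hOmega : polyhedral_lipschitz_domain Omega)
  (k1 k2 : R) (K : 'rV[R]_d -> 'M[R]_d) (hK : elliptic Omega k1 k2 K)
  (hs : set R) (hs_gt0 : forall h, hs h -> 0 < h)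
  (sigma : R) (D : R -> discretization R d)
  (hD : forall h, hs h -> discretization_of Omega sigma h (D h))
  (beta : R) (hbeta : 0 < beta)
  (h_inf_sup : forall h, hs h -> inf_sup Omega beta (D h))
  (h_div : forall h, hs h -> forall u : Hh (D h), Lh Omega (D h) (dvg u)) :
  (exists c C : R, 0 < c /\ c <= C /\
     forall h, hs h -> forall lambda : R[i],
       complex_eigenvalue
         ((calP Omega K (D h))^-1 \o calA Omega K (D h))%VF lambda ->
       exists2 t : R, lambda = (t%:C)%C & t \in `[- C, - c] \/ t \in `[c, C])
  /\
  (forall eps : R, 0 < eps -> exists k : nat, forall h, hs h ->
     forall (b1 : dual_space (subvs_of (Hh0 (D h))))
            (b2 : dual_space (Lh0 (D h)))
            (x0 : subvs_of (Hh0 (D h)) * Lh0 (D h)),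
     let A := calA Omega K (D h) in
     let P := calP Omega K (D h) in
     let b := dual_pair b1 b2 in
     (exists x, minres_iterate A P b x0 k x) /\
     forall x, minres_iterate A P b x0 k x ->
       dual_norm P (residual A b x) <= eps * dual_norm P (residual A b x0)).
Proof.
have [oOmega _] : open Omega /\ connected Omega by case: hOmega.
have mOmega := open_measurable_rV Omega oOmega.
have d_gt0 : (0 < d)%N by case: hd => ->.
have [l1 [l2 [l1_gt0 l2_gt0 K_elliptic]]] := elliptic_constants Omega k1 k2 K d_gt0 hK.
have mK := hK.1.
pose s := (darcy_stability l1 beta)^-1.
have st_gt0 : 0 < darcy_stability l1 beta.
  exact: lt_le_trans ltr01 (stability_constant_ge1 _).
have s_gt0 : 0 < s by rewrite invr_gt0.
have s_le1 : s <= 1 by rewrite invf_le1// stability_constant_ge1.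
have A_sym h (hh : hs h) := calA_symmetric mOmega l1_gt0 mK K_elliptic (hD h hh).
have P_sym h (hh : hs h) := calP_symmetric mOmega l1_gt0 mK K_elliptic (hD h hh).
have P_ge0 h (hh : hs h) :=
  calP_ge0 mOmega l1_gt0 l2_gt0 mK K_elliptic (hD h hh).
have P_eq0 h (hh : hs h) :=
  calP_eq0 mOmega l1_gt0 l2_gt0 mK K_elliptic (hD h hh).
have T_le h (hh : hs h) :=
  darcy_le mOmega l1_gt0 l2_gt0 mK K_elliptic (hD h hh) (h_div h hh).
have T_ge h (hh : hs h) := darcy_ge mOmega l1_gt0 l2_gt0 mK K_elliptic
  (hD h hh) hbeta (h_inf_sup h hh) (h_div h hh).
split.
- exists (Num.sqrt s), 1; split; first by rewrite sqrtr_gt0.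
  split; first by rewrite -[leRHS]sqrtr1 ler_wsqrtr.
  move=> h hh lambda /(preconditioned_eigenvalues _ _ (A_sym h hh) (P_sym h hh)
    (P_ge0 h hh) (P_eq0 h hh) (T_ge h hh) (T_le h hh))[t -> t_bounds].
  exists t => //; rewrite !in_itv /=.
  case: (lerP 0 t) t_bounds => [t0|t0].
    by rewrite ger0_norm//; right.
  by rewrite ltr0_norm// => /andP[h1 h2]; left; apply/andP; split; lra.
- move=> eps eps_gt0.
  have [|m m_eps] := geometric_le_eps (1 - s) eps _ eps_gt0.
    by rewrite ger0_norm ?subr_ge0//; lra.
  exists m.*2 => h hh b1 b2 x0 A P b; split.
    exact: minres_iterate_exists (P_sym h hh) (P_ge0 h hh) (P_eq0 h hh) _ _ _.
  move=> x /(minres_contraction _ _ (A_sym h hh) (P_sym h hh) (P_ge0 h hh)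
    (P_eq0 h hh) (T_ge h hh) (T_le h hh)) /le_trans; apply.
  by rewrite ler_wpM2r// sqrtr_ge0.
Qed.
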